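(* The problem $P|r_j,\mathrm{prec},p_j=1|k\text{-sched},C_{\max}$ can be solved in $\mathcal{O}(8^k k(|V|+|E|))$ time, where $G=(V,E)$ is the precedence graph given as input (assuming basic arithmetic operations on release dates take constant time).
   Context: Problem $P|r_j,\mathrm{prec},p_j=1|k\text{-sched},C_{\max}$: the input consists of a number $m$ of identical parallel machines, a set $V$ of jobs, each of processing time $1$ and with an integer release date $r_j$, a directed acyclic precedence graph $G=(V,E)$ (an arc/path from $a$ to $b$ means $a\prec b$), and an integer $k$. A (partial) schedule selects a subset of jobs to process and assigns each selected job to a machine and an integer time slot, with at most one job per machine per slot; a job may be placed in slot $s$ only if $s\ge r_j$, and if a selected job $b$ has $a\prec b$, then $a$ must also be selected and placed in an earlier slot. The makespan is the largest slot used. The goal is to find a schedule processing at least $k$ jobs with minimum makespan (equivalently, to decide for a given $C_{\max}$ whether a feasible schedule processing at least $k$ jobs with makespan at most $C_{\max}$ exists). *)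

(* Defs.v *)
From mathcomp Require Import all_boot all_order all_algebra.
From mathcomp Require Import constructive_ereal.
Set Implicit Arguments.
Unset Strict Implicit.
Unset Printing Implicit Defensive.
Import Order.TTheory GRing.Theory Num.Theory.

(** * The scheduling problem *)

Record instance := Instance {
  jobs : nat;
  machines : nat;
  target : nat;
  release : 'I_jobs -> int;
  arcs : seq ('I_jobs * 'I_jobs);
  arcs_uniq : uniq arcs;
  arcs_acyclic : forall a b, (a, b) \in arcs ->
    ~~ connect (fun x y => (x, y) \in arcs) b a
}.

Section Scheduling.
Variable I : instance.
Local Notation V := 'I_(jobs I).

Definition arc : rel V := fun a b => (a, b) \in arcs I.

(* There is a path with at least one arc from a to b. *)
Definition prec (a b : V) : bool := [exists c, arc a c && connect arc c b].

(* [None] for a job that is not selected, [Some (p, s)] for a job processed on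
   machine p in slot s. *)
Definition schedule := {ffun V -> option ('I_(machines I) * int)}.

Definition selected (S : schedule) : {set V} := [set j | isSome (S j)].

Record feasible (S : schedule) : Prop := Feasible {
  one_job_per_machine_slot : forall i j p s,
    S i = Some (p, s) -> S j = Some (p, s) -> i = j;
  respects_release : forall j p s,
    S j = Some (p, s) -> (release j <= s)%R;
  respects_prec : forall a b q t, prec a b -> S b = Some (q, t) ->
    exists p s, S a = Some (p, s) /\ (s < t)%R
}.

Definition slot (S : schedule) (j : V) : \bar int :=
  if S j is Some (_, s) then (s%:E)%E else (-oo)%E.

(* Slots are arbitrary integers, so the empty schedule gets makespan -oo. *)
Definition makespan (S : schedule) : \bar int :=
  \big[Order.max/(-oo)%E]_(j in selected S) slot S j.

Definition k_schedule (S : schedule) : Prop :=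
  feasible S /\ target I <= #|selected S|.

Definition optimal (S : schedule) : Prop :=
  k_schedule S /\
  forall S' : schedule, k_schedule S' -> (makespan S <= makespan S')%O.

End Scheduling.

(** * Random access machine with unit-cost additive arithmetic

   A program refers to finitely many integer registers and finitely many
   integer arrays with random access.  The only arithmetic operations are
   addition, subtraction and comparison: unit-cost multiplication would make
   the model unreasonably strong.  Every syntax node that is evaluated costs
   one unit of time. *)

Inductive expr :=
  | EConst of int
  | EReg of nat
  | EGet of nat & expr          (* EGet a e : entry e of array a *)
  | EAdd of expr & expr
  | ESub of expr & expr.

Inductive test :=
  | TLe of expr & expr
  | TEq of expr & expr
  | TNot of test
  | TAnd of test & test.

Inductive cmd :=
  | CSkip
  | CAssign of nat & expr
  | CStore of nat & expr & expr (* CStore a e e' : entry e of array a := e' *)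
  | CSeq of cmd & cmd
  | CIf of test & cmd & cmd
  | CWhile of test & cmd.

Record state := State { reg : nat -> int; arr : nat -> int -> int }.

Definition set_reg (st : state) (x : nat) (v : int) : state :=
  State (fun y => if y == x then v else reg st y) (arr st).

Definition set_arr (st : state) (a : nat) (i v : int) : state :=
  State (reg st)
    (fun b j => if (b == a) && (j == i) then v else arr st b j).

Fixpoint eval (st : state) (e : expr) : int :=
  match e with
  | EConst z => z
  | EReg x => reg st x
  | EGet a e1 => arr st a (eval st e1)
  | EAdd e1 e2 => (eval st e1 + eval st e2)%R
  | ESub e1 e2 => (eval st e1 - eval st e2)%R
  end.

Fixpoint holds (st : state) (b : test) : bool :=
  match b with
  | TLe e1 e2 => (eval st e1 <= eval st e2)%R
  | TEq e1 e2 => eval st e1 == eval st e2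
  | TNot b1 => ~~ holds st b1
  | TAnd b1 b2 => holds st b1 && holds st b2
  end.

Fixpoint expr_cost (e : expr) : nat :=
  match e with
  | EConst _ | EReg _ => 1
  | EGet _ e1 => (expr_cost e1).+1
  | EAdd e1 e2 | ESub e1 e2 => (expr_cost e1 + expr_cost e2).+1
  end.

Fixpoint test_cost (b : test) : nat :=
  match b with
  | TLe e1 e2 | TEq e1 e2 => (expr_cost e1 + expr_cost e2).+1
  | TNot b1 => (test_cost b1).+1
  | TAnd b1 b2 => (test_cost b1 + test_cost b2).+1
  end.

(* [exec c st t st'] : started in st, c halts in st' after t units of time. *)
Inductive exec : cmd -> state -> nat -> state -> Prop :=
  | ExecSkip st : exec CSkip st 1 st
  | ExecAssign x e st :
      exec (CAssign x e) st (expr_cost e).+1 (set_reg st x (eval st e))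
  | ExecStore a e e' st :
      exec (CStore a e e') st (expr_cost e + expr_cost e').+1
        (set_arr st a (eval st e) (eval st e'))
  | ExecSeq c1 c2 st t1 st1 t2 st2 :
      exec c1 st t1 st1 -> exec c2 st1 t2 st2 ->
      exec (CSeq c1 c2) st (t1 + t2) st2
  | ExecIf b c1 c2 st t st' :
      exec (if holds st b then c1 else c2) st t st' ->
      exec (CIf b c1 c2) st (test_cost b + t).+1 st'
  | ExecWhileEnd b c st :
      ~~ holds st b -> exec (CWhile b c) st (test_cost b).+1 st
  | ExecWhileStep b c st t1 st1 t2 st2 :
      holds st b -> exec c st t1 st1 -> exec (CWhile b c) st1 t2 st2 ->
      exec (CWhile b c) st (test_cost b + t1 + t2).+1 st2.

Lemma exec_deterministic c st t1 st1 t2 st2 :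
  exec c st t1 st1 -> exec c st t2 st2 -> t1 = t2 /\ st1 = st2.
Proof.
move=> H; elim: H t2 st2 => {c st t1 st1}.
- by move=> st t2 st2 H; inversion H.
- by move=> x e st t2 st2 H; inversion H.
- by move=> a e e' st t2 st2 H; inversion H.
- move=> c1 c2 st t1 st1 t2 st2 _ IH1 _ IH2 t3 st3 H.
  inversion H as [| | |? ? ? u1 s1 u2 s2 E1 E2| | |]; subst.
  by have [? ?] := IH1 _ _ E1; subst; have [? ?] := IH2 _ _ E2; subst.
- move=> b c1 c2 st t st' _ IH t3 st3 H.
  inversion H as [| | | |? ? ? ? u s E| |]; subst.
  by have [? ?] := IH _ _ E; subst.
- move=> b c st Hb t3 st3 H; inversion H; subst => //.
  by rewrite (negPf Hb) in H2.
- move=> b c st t1 st1 t2 st2 Hb _ IH1 _ IH2 t3 st3 H.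
  inversion H as [| | | | |? ? ? N|? ? ? u1 s1 u2 s2 _ E1 E2]; subst.
    by rewrite Hb in N.
  by have [? ?] := IH1 _ _ E1; subst; have [? ?] := IH2 _ _ E2; subst.
Qed.

(** * Input and output conventions *)

(* Registers 0-3 hold |V|, |E|, m and k.  Array 0 holds the release dates, and
   arrays 1 and 2 the tails and heads of the arcs, in the order of the list.
   Everything else is 0. *)
Definition input_reg (I : instance) (x : nat) : int :=
  match x with
  | 0 => Posz (jobs I)
  | 1 => Posz (size (arcs I))
  | 2 => Posz (machines I)
  | 3 => Posz (target I)
  | _ => 0%Z
  end.

Definition input_arr (I : instance) (a : nat) (i : int) : int :=
  match a, i with
  | 0, Posz j => if insub j is Some j' then @release I j' else 0%Z
  | 1, Posz j => nth 0%Z [seq Posz (val e.1) | e <- arcs I] j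
  | 2, Posz j => nth 0%Z [seq Posz (val e.2) | e <- arcs I] j
  | _, _ => 0%Z
  end.

Definition input_state (I : instance) : state :=
  State (input_reg I) (input_arr I).

(* Arrays 3, 4 and 5 hold, for each job, whether it is selected, its machine
   and its slot. *)
Definition represents (I : instance) (st : state) (S : schedule I) : Prop :=
  forall j : 'I_(jobs I),
    if S j is Some (p, s) then
      [/\ arr st 3 (Posz (val j)) = 1%Z, arr st 4 (Posz (val j)) = Posz (val p)
        & arr st 5 (Posz (val j)) = s]
    else arr st 3 (Posz (val j)) = 0%Z.

(* Register 4 tells whether a schedule processing at least k jobs exists. *)
Definition solves (I : instance) (st : state) : Prop :=
  (reg st 4 = 1%Z /\ exists S : schedule I, represents st S /\ optimal S) \/
  (reg st 4 = 0%Z /\ forall S : schedule I, ~ k_schedule S).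

(* Main.v *)
(** For a downset [Q] of jobs processed by the end of slot [t], let [s] be the
    first later slot in which some job can be processed, and [A] the jobs
    available in [s].  If [#|Q| + #|A| >= k], filling the machines with jobs of
    [A] from slot [s] on is optimal among the continuations of [Q].  Otherwise
    [#|Q| + #|A| < k], and by an exchange argument some optimal continuation
    processes a nonempty subset [M] of [A] in slot [s], so it is enough to
    branch over the fewer than [2 ^ k] choices of [M]; for a given [Q] only the
    smallest [t] matters.

    A set [Q] at which the search branches is determined by fewer than [k] bits:
    reveal the jobs in order of release date, each as soon as its predecessors
    are known to be in [Q], and write down whether it belongs to [Q]; a rejected
    job is available in slot [s], so [#|Q| + #|A| < k] bounds the length.  Hence
    there are at most [2 ^ k] branching sets and [4 ^ k] recorded ones.  The
    program keeps one best partial schedule per set and extends all of them in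
    [k] Bellman-Ford passes, each in time [O(4 ^ k * 2 ^ k * (|V| + |E|))]. *)

Require Import Defs.
From mathcomp Require Import all_boot all_order all_algebra.
From mathcomp Require Import constructive_ereal zify.
Set Implicit Arguments.
Unset Strict Implicit.
Unset Printing Implicit Defensive.
Import Order.TTheory GRing.Theory Num.Theory.

(** The exchange argument stays small because the future depends only on [Q] and [t]. A [completion]
    forgets machines and keeps a slot function with at most [m] jobs per slot, so one available job
    can be moved into an empty slot while the others stay put; and being completable is monotone in
    [t]. The counting must not mention slots, since records are identified by their sets alone.
    Hence [overtaken] and [early], which enclose the set available in the branching slot from below
    and from above in terms of release dates only. Every recorded set has fewer than [k] jobs. This
    is why [k] passes suffice: in each pass an attainable deadline is either met by the output or
    attainable from a record with one more job, and recorded sets never reach size [k]. The machine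
    offers neither multiplication nor hashing. A set is coded by the number whose binary digits are
    its jobs, computed by additions from a table of powers of two; this number indexes an array, so
    the record of a set is found in constant time. *)

Section Combinatorics.
Variable I : instance.
Local Notation V := 'I_(jobs I).
Local Notation arc := (@Defs.arc I).
Local Notation r := (@release I).
Local Notation m := (machines I).
Local Notation k := (target I).
Implicit Types (Q M D X R : {set V}) (s t u C : int).

(** * Downsets, enabled jobs and available jobs *)

Definition downset Q := [forall a, forall b, arc a b ==> (b \in Q) ==> (a \in Q)].

Definition enabled Q : {set V} :=
  [set j | (j \notin Q) && [forall a, arc a j ==> (a \in Q)]].

Definition avail Q s : {set V} := [set j in enabled Q | (r j <= s)%R].

Lemma enabledP Q j :
  reflect (j \notin Q /\ forall a, arc a j -> a \in Q) (j \in enabled Q).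
Proof.
rewrite inE; apply: (iffP andP) => -[jQ H]; split=> //.
  by move=> a aj; have /forallP/(_ a)/implyP := H; apply.
by apply/forallP=> a; apply/implyP; apply: H.
Qed.

Lemma downsetP Q :
  reflect (forall a b, arc a b -> b \in Q -> a \in Q) (downset Q).
Proof.
apply: (iffP forallP) => [H a b ab bQ | H a].
  by have /forallP/(_ b)/implyP/(_ ab)/implyP := H a; apply.
by apply/forallP=> b; apply/implyP=> ab; apply/implyP; apply: H ab.
Qed.

(** A job of [X] with fewest ancestors works: an arc into it from another job [a] of [X] would give
    [a] strictly fewer, because acyclicity keeps [w] itself out of the ancestors of [a]. *)
Lemma exists_source X j0 : j0 \in X ->
  exists2 w, w \in X & forall a, arc a w -> a \notin X.
Proof.
move=> j0X; pose anc w := [set a | connect arc a w].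
case: (arg_minnP (fun w => #|anc w|) j0X) => w wX min_w; exists w => // a aw.
apply/negP=> /min_w; rewrite leqNgt => /negP; apply; apply: proper_card.
apply/properP; split.
  by apply/subsetP=> b; rewrite !inE => ba; apply: connect_trans ba (connect1 aw).
by exists w; rewrite inE ?connect0 //; apply: arcs_acyclic aw.
Qed.

Lemma exists_enabled Q : #|Q| < jobs I -> exists j, j \in enabled Q.
Proof.
move=> ltQ; have /card_gt0P[j0 j0Q] : 0 < #|~: Q|.
  by rewrite cardsCs setCK card_ord subn_gt0.
have [w] := exists_source j0Q; rewrite inE => wQ src; exists w.
by apply/enabledP; split=> // a /src; rewrite inE negbK.
Qed.

(** * Counting the downsets that the search can reach *)

(** A part of [avail Q s] that does not depend on [s]: once all of [Q] is released, so are these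
    jobs. They include every rejection written down while [Q] is being revealed. *)
Definition overtaken Q : {set V} :=
  [set j in enabled Q | [exists i in Q, (r j <= r i)%R]].

Definition good Q := downset Q && (#|Q| + #|overtaken Q| < k).

(* [D] is the part of [Q] found so far and [X] the jobs known to stay outside.
   Branching on the enabled job of smallest release date, each branch uses up
   one of the fewer than [k] elements of [Q :|: overtaken Q]. *)
Lemma card_good_between D X c : k <= #|D| + #|X| + c ->
  #|[set Q | [&& good Q, D \subset Q & X \subset overtaken Q]]| < 2 ^ c.
Proof.
elim: c D X => [|c IH] D X lek.
  rewrite expn0 ltnS leqn0 cards_eq0; apply/eqP/setP=> Q; rewrite !inE.
  apply/negP=> /and3P[/andP[_ lt] /subset_leq_card h1 /subset_leq_card h2].
  by move: lt; rewrite ltnNge (leq_trans lek) // addn0 leq_add.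
(* A source of [Q :\: D] is enabled relative to [D], and it avoids [X] because overtaken jobs lie
   outside [Q]. *)
have wP Q : good Q -> D \subset Q -> X \subset overtaken Q -> Q != D ->
    exists2 w, w \in Q & w \in enabled D :\: X.
  case/andP=> /downsetP dQ _ sDQ sXQ neq.
  have /set0Pn[j0 j0P] : Q :\: D != set0.
    by rewrite setD_eq0; apply: contraNN neq => sQD; rewrite eqEsubset sQD.
  have [w] := exists_source j0P; rewrite inE => /andP[wD wQ] src; exists w => //.
  rewrite inE; apply/andP; split.
    by apply/negP=> /(subsetP sXQ); rewrite !inE wQ.
  apply/enabledP; split=> // a aw.
  by have := src _ aw; rewrite inE negb_and negbK (dQ _ _ aw wQ) orbF.
have [E0|/set0Pn[v0 v0P]] := eqVneq (enabled D :\: X) set0.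
  apply: (@leq_ltn_trans 1); last by rewrite expnS; have := expn_gt0 2 c; lia.
  rewrite -(cards1 D); apply: subset_leq_card; apply/subsetP=> Q; rewrite !inE.
  case/and3P=> gQ sDQ sXQ; apply/negPn/negP=> /(wP _ gQ sDQ sXQ)[w _].
  by rewrite E0 inE.
(* Minimality makes a rejected [v] overtaken: the job of [Q] provided by [wP] is released no earlier
   than [v]. *)
case: (Order.TotalTheory.arg_minP (fun j => r j) v0P) => v vP min_v.
have : v \in enabled D :\: X := vP; rewrite inE => /andP[vX /enabledP[vD vpred]].
have IH1 := IH (v |: D) X; have IH2 := IH D (v |: X).
rewrite !cardsU1 vX vD in IH1 IH2.
have {}IH1 := IH1 ltac:(lia); have {}IH2 := IH2 ltac:(lia).
set F1 := [set Q | _] in IH1; set F2 := [set Q | _] in IH2.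
(* The strict bound pays for the extra set [D]: [1 + 2 * (2 ^ c - 1) < 2 ^ c.+1]. *)
have : [set Q | [&& good Q, D \subset Q & X \subset overtaken Q]]
    \subset [set D] :|: (F1 :|: F2).
  apply/subsetP=> Q; rewrite !inE => /and3P[gQ sDQ sXQ]; rewrite gQ /=.
  have [//|neq /=] := eqVneq Q D; have [w wQ wE] := wP Q gQ sDQ sXQ neq.
  rewrite !subUset !sub1set sDQ sXQ !andbT /=; case: (boolP (v \in Q)) => //= vQ.
  rewrite inE; apply/andP; split.
    by apply/enabledP; split=> // a /vpred; apply: (subsetP sDQ).
  by apply/existsP; exists w; rewrite wQ; apply: min_v.
move/subset_leq_card => /leq_ltn_trans; apply.
have /leq_ltn_trans -> // : #|[set D] :|: (F1 :|: F2)| <= 1 + (#|F1| + #|F2|).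
  by rewrite cardsU cards1 cardsU; lia.
by rewrite expnS; lia.
Qed.

Lemma card_good : #|[set Q | good Q]| <= 2 ^ k.
Proof.
have := @card_good_between set0 set0 k; rewrite cards0 => /(_ (leqnn _))/ltnW.
by apply: leq_trans; apply: subset_leq_card; apply/subsetP=> Q; rewrite !inE !sub0set => ->.
Qed.

(* Contains [avail Q s] for every [s] at which the search branches. *)
Definition early Q : {set V} :=
  [set j in enabled Q | #|Q| + #|[set i in enabled Q | (r i <= r j)%R]| < k].

(** At the member of [early Q] that is released last, the defining condition counts all of
    [early Q]. *)
Lemma card_early Q : #|early Q| <= k.
Proof.
have [->|/set0Pn[j0 j0P]] := eqVneq (early Q) set0; first by rewrite cards0.
case: (Order.TotalTheory.arg_maxP (fun j => r j) j0P) => v vP max_v.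
have : v \in early Q := vP; rewrite inE => /andP[_ lt].
have : early Q \subset [set i in enabled Q | (r i <= r v)%R].
  apply/subsetP=> i iP; rewrite inE; apply/andP; split; last exact: max_v.
  by move: iP; rewrite inE => /andP[].
by move/subset_leq_card; lia.
Qed.

Definition reachable : {set {set V}} :=
  \bigcup_(Q in [set Q | good Q]) [set Q :|: M | M in powerset (early Q)].

Lemma card_reachable : #|reachable| <= 2 ^ k * 2 ^ k.
Proof.
apply: (@leq_trans (\sum_(Q in [set Q | good Q]) 2 ^ k)); last first.
  by rewrite sum_nat_const leq_mul2r card_good orbT.
rewrite /reachable; elim/big_ind2: _ => [|A a B b hA hB|Q _].
- by rewrite cards0.
- by apply: leq_trans (leq_add hA hB); rewrite cardsU leq_subr.
apply: leq_trans (leq_imset_card _ _) _.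
by rewrite card_powerset leq_pexp2l // card_early.
Qed.

Lemma good_of_avail Q s : downset Q -> (forall j, j \in Q -> (r j <= s)%R) ->
  #|Q| + #|avail Q s| < k -> good Q.
Proof.
move=> dQ rQ lt; rewrite /good dQ /=; apply: leq_ltn_trans lt; rewrite leq_add2l.
apply: subset_leq_card; apply/subsetP=> j; rewrite [j \in overtaken _]inE.
case/andP=> jE /existsP[i /andP[iQ le]]; rewrite inE jE /=.
exact: le_trans le (rQ _ iQ).
Qed.

(** Here [avail Q s] is part of [early Q]: the enabled jobs released no later than an available job
    are themselves available. *)
Lemma reachable_step Q s M : downset Q -> (forall j, j \in Q -> (r j <= s)%R) ->
  #|Q| + #|avail Q s| < k -> M \subset avail Q s -> Q :|: M \in reachable.
Proof.
move=> dQ rQ lt sM; apply/bigcupP; exists Q.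
  by rewrite inE; apply: good_of_avail lt.
apply: imset_f; rewrite powersetE; apply: (subset_trans sM).
apply/subsetP=> j; rewrite inE => /andP[jE rj]; rewrite inE jE /=.
apply: leq_ltn_trans lt; rewrite leq_add2l; apply: subset_leq_card.
apply/subsetP=> i; rewrite !inE => /andP[-> /le_trans le] /=; exact: le.
Qed.

Lemma reachable0 : 0 < k -> set0 \in reachable.
Proof.
move=> k0; apply/bigcupP; exists set0.
  rewrite inE /good cards0; apply/andP; split.
    by apply/downsetP=> a b _; rewrite inE.
  rewrite [overtaken _](_ : _ = set0) ?cards0 //; apply/setP=> j; rewrite !inE.
  apply/negP=> /andP[_ /existsP[i]]; by rewrite inE.
by apply/imsetP; exists set0; rewrite ?setU0 // powersetE sub0set.
Qed.

(** * Completions of a partial schedule *)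

(** [R] holds the jobs still to be processed and [C] is the deadline. Machines are omitted, since at
    most [m] unit jobs of one slot can always be spread over [m] machines. *)
Definition completion Q t C R (f : V -> int) : Prop :=
  [/\ [disjoint R & Q], k <= #|Q| + #|R|,
      forall j, j \in R -> [/\ (t < f j)%R, (f j <= C)%R & (r j <= f j)%R],
      forall a b, arc a b -> b \in R -> a \in Q \/ a \in R /\ (f a < f b)%R
    & forall s, #|[set j in R | f j == s]| <= m].

Definition completable Q t C := exists R f, completion Q t C R f.

Lemma completable_le Q t t' C :
  (t' <= t)%R -> completable Q t C -> completable Q t' C.
Proof.
move=> le [R [f [h1 h2 h3 h4 h5]]]; exists R, f; split=> // j /h3[lt ? ?].
by split=> //; apply: le_lt_trans lt.
Qed.

(* [s] is the first slot after [t] in which a job can follow [Q]. *)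
Definition next_slot Q t s : Prop :=
  [/\ (t < s)%R, forall j, j \in enabled Q -> (s <= t + 1)%R \/ (s <= r j)%R
    & exists j, j \in avail Q s].

(** The job of [R] processed first has all its predecessors in [Q], so it is enabled and cannot run
    before [s]. *)
Lemma completion_ge Q t s C R f : next_slot Q t s -> completion Q t C R f ->
  forall j, j \in R -> (s <= f j)%R.
Proof.
case=> _ hs _ [dis _ hR prec _] j jR.
case: (Order.TotalTheory.arg_minP f jR) => w wR min_w.
apply: le_trans (min_w _ jR); have [tw _ rw] := hR _ wR.
have /hs[le|le] : w \in enabled Q; last exact: le_trans le rw.
  apply/enabledP; split=> [|a aw]; first by rewrite (disjointFr dis wR).
  have [//|[aR]] := prec _ _ aw wR; by rewrite ltNge min_w.
by apply: le_trans le _; lia.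
Qed.

Lemma completable_ex_slot Q t s C : #|Q| < k -> next_slot Q t s ->
  completable Q t C -> (s <= C)%R.
Proof.
move=> ltQ ns [R [f cR]]; have [_ leR hR _ _] := cR.
have /card_gt0P[j jR] : 0 < #|R| by lia.
by have [_ le _] := hR _ jR; apply: le_trans (completion_ge ns cR jR) le.
Qed.

(* If a completion leaves slot [s] empty, an available job can be moved or
   added there. *)
Lemma completable_step Q t s C : 0 < m -> next_slot Q t s ->
  completable Q t C -> exists M,
    [/\ M \subset avail Q s, M != set0, #|M| <= m & completable (Q :|: M) s C].
Proof.
move=> m0 ns [R [f cR]]; have ge := completion_ge ns cR.
have [dis leR hR prec cap] := cR; have [lt_ts _ [j0 j0A]] := ns.
pose M0 := [set j in R | f j == s].
(* The slot function is kept: the jobs of [M] leave [R], and what remains runs after [s] because all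
   of [M0] is gone. For [M = [set j0]] this moves [j0] if it was in [R] and adds it otherwise. *)
have step M : M \subset avail Q s -> M0 \subset M -> completable (Q :|: M) s C.
  move=> sM sM0; exists (R :\: M), f; split.
  - rewrite disjoint_sym disjoints_subset; apply/subsetP=> j; rewrite !inE.
    case/orP=> [jQ|->//]; rewrite negb_and negbK.
    by apply/orP; right; apply/negP=> jR; rewrite (disjointFr dis jR) in jQ.
  - have -> : #|Q :|: M| = #|Q| + #|M|.
      apply/eqP; rewrite (leq_card_setU Q M) disjoint_sym disjoints_subset.
      by apply/subsetP=> j /(subsetP sM); rewrite !inE => /andP[/andP[]].
    have := cardsID M R; have := subset_leq_card (subsetIr R M); lia.
  - move=> j; rewrite inE => /andP[jM jR]; have [_ ? ?] := hR _ jR; split=> //.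
    rewrite lt_neqAle ge // andbT eq_sym; apply: contraNN jM => /eqP fj.
    by apply: (subsetP sM0); rewrite inE jR fj eqxx.
  - move=> a b ab; rewrite inE => /andP[bM bR]; rewrite !inE.
    have [-> |[aR lt]] := prec _ _ ab bR; first by left.
    by case: (a \in M); [left; rewrite orbT | right].
  - move=> u; apply: leq_trans (cap u); apply: subset_leq_card.
    by apply/subsetP=> j; rewrite !inE -andbA => /and3P[_ -> ->].
have [M0_0|M0_n0] := eqVneq M0 set0.
  exists [set j0]; split; rewrite ?cards1 ?sub1set //.
    by apply/set0Pn; exists j0; rewrite inE.
  by apply: step; rewrite ?sub1set // M0_0 sub0set.
have sM0 : M0 \subset avail Q s.
  apply/subsetP=> j; rewrite inE => /andP[jR /eqP fj]; rewrite inE.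
  have [_ _ rj] := hR _ jR; rewrite -fj rj andbT; apply/enabledP.
  split=> [|a aj]; first by rewrite (disjointFr dis jR).
  by have [//|[/ge]] := prec _ _ aj jR; rewrite fj leNgt => /negPf->.
by exists M0; split=> //; [apply: cap | apply: step].
Qed.

(** Pigeonhole over the slots from [s] to [C]. For positive [x], [x.-1 %/ m] is one less than
    [x / m] rounded up. *)
Lemma completable_slots Q t s C : 0 < m -> #|Q| < k -> next_slot Q t s ->
  completable Q t C -> (s + Posz ((k - #|Q|).-1 %/ m) <= C)%R.
Proof.
move=> m0 ltQ ns cC; have le_sC := completable_ex_slot ltQ ns cC.
case: cC => R [f cR]; have ge := completion_ge ns cR.
have [_ leR hR _ cap] := cR; pose n := `|(C - s)%R|%N.
have leRm : #|R| <= n.+1 * m.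
  rewrite -sum1_card (partition_big (fun j => inord `|(f j - s)%R| : 'I_n.+1) predT) //=.
  apply: (@leq_trans (\sum_(i < n.+1) m)); last first.
    by rewrite sum_nat_const card_ord.
  apply: leq_sum => i _; apply: leq_trans (cap (s + Posz i)%R).
  rewrite sum1_card; apply: subset_leq_card; apply/subsetP=> j.
  rewrite !inE unfold_in => /andP[jR /eqP E]; rewrite jR /=.
  have := ge _ jR; have [_ leC _] := hR _ jR => ges.
  by rewrite -E inordK; rewrite /n; lia.
have : (k - #|Q|).-1 %/ m < n.+1 by rewrite ltn_divLR //; lia.
rewrite /n; lia.
Qed.

(** * Partial schedules *)

(** Integer-valued functions on all jobs, matching the arrays of the program; their values outside
    [Q] are arbitrary. *)
Record partial_schedule Q t (f g : V -> int) : Prop := PartialSchedule {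
  ps_slot : forall j, j \in Q -> (r j <= f j)%R /\ (f j <= t)%R;
  ps_machine : forall j, j \in Q -> (0 <= g j < Posz m)%R;
  ps_inj : forall i j, i \in Q -> j \in Q -> f i = f j -> g i = g j -> i = j;
  ps_prec : forall a b, arc a b -> b \in Q -> a \in Q /\ (f a < f b)%R
}.

Lemma ps_downset Q t f g : partial_schedule Q t f g -> downset Q.
Proof. by case=> _ _ _ H; apply/downsetP=> a b /H{}H /H[]. Qed.

(** New jobs run after [t], so they do not collide with old ones; they are enabled, so their
    predecessors are all old and [M] may be spread over several slots in any order. This serves both
    a single branching step and the final filling. *)
Lemma partial_schedule_extend Q t f g M t' f' g' :
  partial_schedule Q t f g -> (t <= t')%R -> M \subset enabled Q ->
  (forall j, j \in M -> [/\ (t < f' j)%R, (f' j <= t')%R & (r j <= f' j)%R]) ->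
  (forall j, j \in M -> (0 <= g' j < Posz m)%R) ->
  {in M &, forall i j, f' i = f' j -> g' i = g' j -> i = j} ->
  (forall j, j \in Q -> f' j = f j /\ g' j = g j) ->
  partial_schedule (Q :|: M) t' f' g'.
Proof.
move=> [sl ma inj prec] tt' sM slM maM injM eqQ.
split=> [j|j|i j|a b ab]; rewrite !inE.
- case/orP=> [jQ|/slM[]//]; have [-> _] := eqQ _ jQ; have [? ?] := sl _ jQ.
  by split=> //; apply: le_trans tt'.
- by case/orP=> [jQ|/maM//]; have [_ ->] := eqQ _ jQ; apply: ma.
- case/orP=> [iQ|iM]; case/orP=> [jQ|jM].
  + by have [-> ->] := eqQ _ iQ; have [-> ->] := eqQ _ jQ; apply: inj.
  + have [-> _] := eqQ _ iQ; have [_ le] := sl _ iQ; have [lt _ _] := slM _ jM.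
    by move=> E; rewrite E in le; lia.
  + have [-> _] := eqQ _ jQ; have [_ le] := sl _ jQ; have [lt _ _] := slM _ iM.
    by move=> E; rewrite E in lt; lia.
  + exact: injM.
case/orP=> [bQ|bM].
  by have [aQ lt] := prec _ _ ab bQ; rewrite aQ; have [-> _] := eqQ _ aQ;
     have [-> _] := eqQ _ bQ.
have /enabledP[_ /(_ _ ab) aQ] := subsetP sM _ bM; rewrite aQ; split=> //.
have [-> _] := eqQ _ aQ; have [_ le] := sl _ aQ; have [lt _ _] := slM _ bM.
exact: le_lt_trans le lt.
Qed.

Lemma prec_ps Q t f g a b : partial_schedule Q t f g -> prec a b -> b \in Q ->
  a \in Q /\ (f a < f b)%R.
Proof.
move=> P /existsP[c /andP[ac /connectP[p cp eb]]]; rewrite eb => {b eb}.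
elim: p c a ac cp => [|d p IH] c a ac /=; first by move=> _; apply: ps_prec P _ _ ac.
case/andP=> cd dp lQ; have [cQ lt] := IH d c cd dp lQ.
by have [aQ lt'] := ps_prec P ac cQ; split=> //; apply: lt_trans lt.
Qed.

Lemma schedule_of_partial Q C f g : partial_schedule Q C f g ->
  exists S : schedule I,
    [/\ feasible S, selected S = Q, (makespan S <= C%:E)%O
      & forall j, if S j is Some (p, s)
                  then [/\ j \in Q, Posz p = g j & s = f j] else j \notin Q].
Proof.
move=> P; have Hp j : j \in Q -> `|g j|%N < m by move=> /(ps_machine P); lia.
pose S : schedule I := [ffun j => if insub `|g j|%N is Some p then
  if j \in Q then Some (p, f j) else None else None].
have SE j : if S j is Some (p, s)
            then [/\ j \in Q, Posz p = g j & s = f j] else j \notin Q.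
  rewrite /S ffunE; case: (boolP (j \in Q)) => jQ.
    rewrite insubT ?Hp // => h /=; split=> //; have := ps_machine P jQ; lia.
  by case: insubP.
have SQ j p s : S j = Some (p, s) -> [/\ j \in Q, Posz p = g j & s = f j].
  by move=> E; have := SE j; rewrite E.
have selE : selected S = Q.
  apply/setP=> j; rewrite inE; have := SE j; case: (S j) => [[p s] [-> //]|].
  by move=> /negPf->.
exists S; split=> //.
- split.
  + move=> i j p s /SQ[iQ pi si] /SQ[jQ pj sj].
    by apply: (ps_inj P); rewrite -?si -?sj -?pi -?pj.
  + by move=> j p s /SQ[jQ _ ->]; case: (ps_slot P jQ).
  + move=> a b q t ab /SQ[bQ _ ->]; have [aQ lt] := prec_ps P ab bQ.
    have := SE a; case: (S a) => [[p s] [_ _ ->]|]; last by rewrite aQ.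
    by exists p, (f a).
- apply/bigmax_leP; split; first exact: leNye.
  move=> j; rewrite selE => jQ; rewrite /slot; case E: (S j) => [[p s]|].
    by have [_ _ ->] := SQ _ _ _ E; rewrite lee_fin; case: (ps_slot P jQ).
  exact: leNye.
- by move=> j; have := SE j; case: (S j) => [[p s]|].
Qed.

Lemma completable_of_schedule (S : schedule I) t C : k_schedule S ->
  (makespan S <= C%:E)%O -> (forall j, (t < r j)%R) -> completable set0 t C.
Proof.
case=> -[one rel prec] ksel mk tr.
pose f j := if S j is Some (_, s) then s else 0%Z.
have fS j : j \in selected S -> exists p, S j = Some (p, f j).
  by rewrite inE /f; case: (S j) => [[p s]|] // _; exists p.
exists (selected S), f; split.
- by rewrite disjoint_sym disjoints_subset sub0set.
- by rewrite cards0.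
- move=> j jS; have [p E] := fS _ jS; have le := rel _ _ _ E.
  split=> //; first exact: lt_le_trans (tr j) le.
  have : (slot S j <= C%:E)%O.
    by apply: le_trans mk; apply: (@le_bigmax_cond _ _ _ _ _ (mem (selected S))).
  by rewrite /slot E lee_fin.
- move=> a b ab bS; right; have [q E] := fS _ bS.
  have [|p [s [Ea lt]]] := prec a b q (f b) _ E.
    by apply/existsP; exists b; rewrite ab connect0.
  by rewrite inE Ea; split=> //; rewrite {1}/f Ea.
(* The machine assignment is injective on each slot, which gives the capacity bound. Its default
   value [p0] needs a machine; without machines nothing is selected. *)
- move=> s; have [m0|m0] := posnP m.
    rewrite [X in _ <= X]m0 leqn0 cards_eq0; apply/eqP/setP=> j; rewrite !inE.
    by apply/negP=> /andP[]; case: (S j) => [[p ?]|] // _ _;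
       have := ltn_ord p; rewrite [X in _ < X]m0.
  pose p0 := Ordinal m0.
  pose h j := if S j is Some (p, _) then p else p0.
  rewrite -[X in _ <= X](card_ord m) -(@card_in_imset _ _ h _).
    exact: max_card.
  move=> i j; rewrite !inE => /andP[iS /eqP fi] /andP[jS /eqP fj].
  have [p Ei] := fS i ltac:(by rewrite inE); have [q Ej] := fS j ltac:(by rewrite inE).
  rewrite /h Ei Ej => epq; apply: (one _ _ p s); first by rewrite Ei fi.
  by rewrite Ej fj epq.
Qed.

End Combinatorics.

(** * Total correctness with a time bound *)

Definition runs c st n (P : state -> Prop) : Prop :=
  exists t st', [/\ exec c st t st', t <= n & P st'].

Fixpoint mod_regs c : seq nat :=
  match c with
  | CSkip | CStore _ _ _ => [::]
  | CAssign x _ => [:: x]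
  | CSeq c1 c2 | CIf _ c1 c2 => mod_regs c1 ++ mod_regs c2
  | CWhile _ c1 => mod_regs c1
  end.

Fixpoint mod_arrs c : seq nat :=
  match c with
  | CSkip | CAssign _ _ => [::]
  | CStore a _ _ => [:: a]
  | CSeq c1 c2 | CIf _ c1 c2 => mod_arrs c1 ++ mod_arrs c2
  | CWhile _ c1 => mod_arrs c1
  end.

(** A frame condition read off the syntax: a specification describes only what changes, and the rest
    follows by computing membership in a closed list, which is what the many [isT] arguments do. *)
Definition unchanged c st st' : Prop :=
  (forall x, x \notin mod_regs c -> reg st' x = reg st x) /\
  (forall a i, a \notin mod_arrs c -> arr st' a i = arr st a i).

Lemma exec_unchanged c st t st' : exec c st t st' -> unchanged c st st'.
Proof.
elim=> {c st t st'}.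
- by split.
- by move=> x e st; split=> //= y; rewrite inE => /negPf->.
- by move=> a e e' st; split=> //= b i; rewrite inE => /negPf->.
- move=> c1 c2 st t1 st1 t2 st2 _ [r1 a1] _ [r2 a2]; split=> /= [x|a i];
    rewrite mem_cat negb_or => /andP[h1 h2]; first by rewrite r2 // r1.
  by rewrite a2 // a1.
- move=> b c1 c2 st t st' _ [r1 a1]; split=> /= [x|a i];
    rewrite mem_cat negb_or => /andP[h1 h2].
    by apply: r1; case: ifP.
  by apply: a1; case: ifP.
- by split.
- move=> b c st t1 st1 t2 st2 _ _ [r1 a1] _ [r2 a2]; split=> /= [x|a i] h.
    by rewrite r2 // r1.
  by rewrite a2 // a1.
Qed.

Lemma runs_weak c st n n' (P P' : state -> Prop) : runs c st n P ->
  n <= n' -> (forall st', P st' -> P' st') -> runs c st n' P'.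
Proof.
move=> [t [st' [ex le Pst]]] le' PP'; exists t, st'; split=> //.
  exact: leq_trans le'.
exact: PP'.
Qed.

Lemma runs_unchanged c st n P : runs c st n P ->
  runs c st n (fun st' => P st' /\ unchanged c st st').
Proof.
move=> [t [st' [ex le Pst]]]; exists t, st'; split=> //; split=> //.
exact: exec_unchanged ex.
Qed.

Lemma runs_seq c1 c2 st n1 n2 (P1 P : state -> Prop) : runs c1 st n1 P1 ->
  (forall st1, P1 st1 -> runs c2 st1 n2 P) -> runs (CSeq c1 c2) st (n1 + n2) P.
Proof.
move=> [t1 [st1 [ex1 le1 P1st]]] /(_ _ P1st)[t2 [st2 [ex2 le2 Pst]]].
by exists (t1 + t2), st2; split; [apply: ExecSeq ex1 ex2 | apply: leq_add |].
Qed.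

Lemma runs_if b c1 c2 st n P :
  runs (if holds st b then c1 else c2) st n P ->
  runs (CIf b c1 c2) st (test_cost b + n).+1 P.
Proof.
move=> [t [st' [ex le Pst]]]; exists (test_cost b + t).+1, st'.
by split=> //; [apply: ExecIf | rewrite ltnS leq_add2l].
Qed.

(* [f] bounds the number of remaining iterations. *)
Lemma runs_while b c n (Inv : nat -> state -> Prop) (P : state -> Prop) :
  (forall f st, Inv f st -> ~~ holds st b -> P st) ->
  (forall f st, Inv f st -> holds st b -> 0 < f /\ runs c st n (Inv f.-1)) ->
  forall f st, Inv f st ->
    runs (CWhile b c) st (f * (test_cost b + n).+1 + (test_cost b).+1) P.
Proof.
move=> Hend Hstep; elim=> [|f IH] st Ist; case: (boolP (holds st b)) => hb.
- by have [] := Hstep _ _ Ist hb.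
- exists (test_cost b).+1, st; split; [exact: ExecWhileEnd | by [] |].
  exact: Hend _ _ Ist hb.
- have [_ [t1 [st1 [ex1 le1 I1]]]] := Hstep _ _ Ist hb.
  have [t2 [st2 [ex2 le2 Pst]]] := IH _ I1.
  exists (test_cost b + t1 + t2).+1, st2; split=> //.
    exact: ExecWhileStep hb ex1 ex2.
  by rewrite mulSn; lia.
- exists (test_cost b).+1, st; split; first exact: ExecWhileEnd.
    by rewrite leq_addl.
  exact: Hend _ _ Ist hb.
Qed.

Fixpoint straight c : bool :=
  match c with
  | CSkip | CAssign _ _ | CStore _ _ _ => true
  | CSeq c1 c2 | CIf _ c1 c2 => straight c1 && straight c2
  | CWhile _ _ => false
  end.

(** Denotation of loop-free code, so that loop bodies are verified by computation. The value at
    [CWhile] is a dummy ruled out by [straight]. *)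
Fixpoint sem c st : state :=
  match c with
  | CSkip | CWhile _ _ => st
  | CAssign x e => set_reg st x (eval st e)
  | CStore a e e' => set_arr st a (eval st e) (eval st e')
  | CSeq c1 c2 => sem c2 (sem c1 st)
  | CIf b c1 c2 => if holds st b then sem c1 st else sem c2 st
  end.

Fixpoint max_cost c : nat :=
  match c with
  | CSkip | CWhile _ _ => 1
  | CAssign _ e => (expr_cost e).+1
  | CStore _ e e' => (expr_cost e + expr_cost e').+1
  | CSeq c1 c2 => max_cost c1 + max_cost c2
  | CIf b c1 c2 => (test_cost b + maxn (max_cost c1) (max_cost c2)).+1
  end.

Lemma runs_straight c st (P : state -> Prop) : straight c -> P (sem c st) ->
  runs c st (max_cost c) P.
Proof.
move=> sc Pst; suff [t [st' [ex le E]]] : runs c st (max_cost c) (eq (sem c st)).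
  by exists t, st'; split=> //; rewrite -E.
elim: c st sc {P Pst} => [|x e|a e e'|c1 IH1 c2 IH2|b c1 IH1 c2 IH2|] //= st.
- by exists 1, st; split=> //; constructor.
- by exists (expr_cost e).+1, (set_reg st x (eval st e)); split=> //; constructor.
- exists (expr_cost e + expr_cost e').+1, (set_arr st a (eval st e) (eval st e')).
  by split=> //; constructor.
- case/andP=> s1 s2; apply: (runs_seq (IH1 _ s1)) => st1 <-; exact: IH2.
- case/andP=> s1 s2; apply: runs_if; case: ifP => _.
    by apply: runs_weak (IH1 _ s1) _ _ => //; rewrite leq_maxl.
  by apply: runs_weak (IH2 _ s2) _ _ => //; rewrite leq_maxr.
Qed.

Lemma sem_unchanged c st : straight c -> unchanged c st (sem c st).
Proof.
move=> sc; have [t [st' [ex _ ->]]] := runs_straight sc (erefl (sem c st)).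
exact: exec_unchanged ex.
Qed.

Lemma unchanged_trans c st1 st2 st3 :
  unchanged c st1 st2 -> unchanged c st2 st3 -> unchanged c st1 st3.
Proof.
move=> [r12 a12] [r23 a23]; split=> [x h|a i h]; first by rewrite r23 ?r12.
by rewrite a23 ?a12.
Qed.

Lemma unchanged_sub c c' st st' : unchanged c' st st' ->
  all [in mod_regs c] (mod_regs c') && all [in mod_arrs c] (mod_arrs c') ->
  unchanged c st st'.
Proof.
case=> [U1 U2] /andP[/allP h1 /allP h2]; split=> [x|a i] h.
  by apply: U1; apply: contraNN h => /h1.
by apply: U2; apply: contraNN h => /h2.
Qed.

Definition CFor x b body : cmd :=
  CSeq (CAssign x (EConst 0))
    (CWhile (TLe (EAdd (EReg x) (EConst 1)) (EReg b))
      (CSeq body (CAssign x (EAdd (EReg x) (EConst 1))))).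

(** An iteration adds 5 for the test, 4 for the increment and 1 for the loop node, hence 10; the
    initial assignment costs 2 and the failing test 6, hence 8. The body may rely on [unchanged]
    relative to the state before the loop. *)
Lemma runs_for x b body n kb st (Inv : nat -> state -> Prop) :
  (x \notin mod_regs body) && (b \notin x :: mod_regs body) ->
  reg st b = Posz n -> Inv 0 (set_reg st x 0) ->
  (forall (i : 'I_n) st', reg st' x = Posz i ->
     unchanged (CFor x b body) st st' -> Inv i st' ->
     runs body st' kb (fun st2 => Inv i.+1 (set_reg st2 x (Posz i.+1)))) ->
  runs (CFor x b body) st (n * (kb + 10) + 8)
    (fun st' => Inv n st' /\ unchanged (CFor x b body) st st').
Proof.
case/andP=> xmod; rewrite inE negb_or => /andP[bx bmod] Eb I0 step.
apply: runs_unchanged.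
pose J f st' := exists i, [/\ i + f = n, reg st' x = Posz i,
  unchanged (CFor x b body) st st' & Inv i st'].
apply: runs_weak (runs_seq (n1 := 2) (n2 := n * (kb + 10) + 6)
  (P1 := J n) _ _) _ (fun st' H => H); last by lia.
- exists 2, (set_reg st x 0); split=> //; first exact: (ExecAssign x (EConst 0)).
  exists 0; split=> //=; first by rewrite eqxx.
  by split=> //= y; rewrite inE negb_or => /andP[/negPf->].
move=> st1 J1.
have bunch st' : unchanged (CFor x b body) st st' -> reg st' b = Posz n.
  move=> [-> //]; rewrite /= inE mem_cat inE; rewrite (negPf bx) (negPf bmod).
  by rewrite ?orbF.
apply: runs_weak (runs_while (n := kb + 4) (Inv := J) _ _ J1) _ (fun st' H => H).
- move=> f st' [i [fi Ex U Ii]] /=; rewrite Ex (bunch _ U) => h.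
  by rewrite (_ : n = i) //; lia.
- move=> f st' [i [fi Ex U Ii]] /=; rewrite Ex (bunch _ U) => h.
  have lti : i < n by lia.
  split; first by lia.
  apply: runs_seq (runs_unchanged (step (Ordinal lti) _ Ex U Ii)) _ => st2 [I2 U2].
  exists 4, (set_reg st2 x (Posz i.+1)); split=> //.
    have -> : Posz i.+1 = eval st2 (EAdd (EReg x) (EConst 1)).
      by rewrite /= (U2.1 _ xmod) Ex; lia.
    exact: ExecAssign.
  exists i.+1; split=> //=; [by lia | by rewrite eqxx |].
  case: U U2 => [U1 U2] [U3 U4]; split=> /= [y|a j].
    rewrite inE mem_cat inE !negb_or => /and3P[yx ym _].
    rewrite (negPf yx) U3 // U1 //= inE mem_cat inE.
    by rewrite (negPf yx) (negPf ym).
  by rewrite cats0 => am; rewrite U4 // U2 //= cats0.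
by rewrite /=; lia.
Qed.

Lemma runs_seq_straight c1 c2 st n P : straight c1 -> runs c2 (sem c1 st) n P ->
  runs (CSeq c1 c2) st (max_cost c1 + n) P.
Proof.
move=> s1 H; apply: (runs_seq (runs_straight s1 (erefl (sem c1 st)))) => st1 <-.
exact: H.
Qed.

(** * Prefix sums over the jobs *)

Section PrefixSums.
Variable n : nat.
Implicit Types (A M Q : {set 'I_n}) (F : 'I_n -> nat).

(** The loops visit jobs in index order, so their counters are described by sums over an initial
    segment. *)
Definition prefix_sum F i := \sum_(x < n | x < i) F x.

Lemma prefix_sum0 F : prefix_sum F 0 = 0.
Proof. by rewrite /prefix_sum big_pred0. Qed.

Lemma prefix_sumS F (x : 'I_n) : prefix_sum F x.+1 = prefix_sum F x + F x.
Proof.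
rewrite /prefix_sum (bigD1 x) //= addnC; congr (_ + _); apply: eq_bigl => y.
by rewrite ltnS andbC -val_eqE /= ltn_neqAle.
Qed.

Lemma prefix_sum_total F : prefix_sum F n = \sum_(x < n) F x.
Proof. by apply: eq_bigl => x; rewrite ltn_ord. Qed.

Lemma prefix_ind (P : nat -> Prop) :
  P 0 -> (forall x : 'I_n, P x -> P x.+1) -> forall i, i <= n -> P i.
Proof. by move=> P0 PS; elim=> // i IH lti; apply: (PS (Ordinal lti)); apply/IH/ltnW. Qed.

(** At a member of [A] this is its position within [A]. It serves as the order of filling, as a
    machine number and as the position of a binary digit. *)
Definition rank A i := prefix_sum (fun x => x \in A) i.

Lemma rank_total A : rank A n = #|A|.
Proof. by rewrite /rank prefix_sum_total -sum1_card [RHS]big_mkcond. Qed.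

Lemma leq_rank A i j : i <= j -> rank A i <= rank A j.
Proof.
move=> ij; rewrite /rank /prefix_sum big_mkcond [X in _ <= X]big_mkcond.
by apply: leq_sum => x _; case: ifP => // xi; rewrite (leq_trans xi ij).
Qed.

Lemma ltn_rank A (x y : 'I_n) : x \in A -> x < y -> rank A x < rank A y.
Proof.
move=> xA xy; apply: leq_trans (leq_rank A xy).
by rewrite /rank prefix_sumS xA addn1.
Qed.

Lemma rank_inj A : {in A &, forall x y : 'I_n, rank A x = rank A y -> x = y}.
Proof.
move=> x y xA yA E; apply: val_inj; case: (ltngtP x y) => // lt.
  by have := ltn_rank xA lt; rewrite E ltnn.
by have := ltn_rank yA lt; rewrite E ltnn.
Qed.

Lemma ltn_rank_card A (x : 'I_n) : x \in A -> rank A x < #|A|.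
Proof.
move=> xA; rewrite -rank_total; apply: leq_trans (leq_rank A (ltn_ord x)).
by rewrite /rank prefix_sumS xA addn1.
Qed.

Lemma card_rank_lt A c : #|[set x in A | rank A x < c]| = minn #|A| c.
Proof.
set B := [set x in A | _]; rewrite -!rank_total.
suff H i : i <= n -> rank B i = minn (rank A i) c by apply: H.
move: i; apply: prefix_ind => [|x IH]; first by rewrite /rank !prefix_sum0 min0n.
rewrite /rank !prefix_sumS -!/(rank _ _) {}IH !inE.
by case: (x \in A); case: (ltnP (rank A x) c) => /=; lia.
Qed.

(* Rank of a subset [M] of [A] in the order in which a binary counter over [A]
   enumerates them. *)
Definition weight A M i := prefix_sum (fun x => (x \in M) * 2 ^ rank A x) i.

Lemma weight_lt A M i : M \subset A -> i <= n -> weight A M i < 2 ^ rank A i.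
Proof.
move=> sMA; move: i; apply: prefix_ind => [|x IH].
  by rewrite /weight prefix_sum0 expn_gt0.
rewrite /weight /rank !prefix_sumS -!/(rank _ _) -/(weight _ _ _) expnD.
move: IH; case: (boolP (x \in M)) => [/(subsetP sMA)->|_]; first by rewrite /=; lia.
by case: (x \in A) => /=; lia.
Qed.

Lemma leq_weight A M M' i : M \subset M' -> weight A M i <= weight A M' i.
Proof.
move=> sMM'; apply: leq_sum => x _; rewrite leq_mul2r; apply/orP; right.
by case: (boolP (x \in M)) => // /(subsetP sMM') ->.
Qed.

(** Uniqueness of binary expansions, from the top digit down: by [weight_lt] the lower digits cannot
    compensate a difference in the highest one. *)
Lemma weight_inj A M M' : M \subset A -> M' \subset A ->
  weight A M n = weight A M' n -> M = M'.
Proof.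
move=> sM sM' E; apply/setP=> x.
suff H i : i <= n -> weight A M i = weight A M' i ->
    forall y : 'I_n, y < i -> (y \in M) = (y \in M').
  exact: (H n (leqnn n) E x (ltn_ord x)).
move: {x E} i; apply: prefix_ind => [//|x IH].
rewrite /weight !prefix_sumS -!/(weight _ _ _) => E.
have l1 := weight_lt sM (ltnW (ltn_ord x)).
have l2 := weight_lt sM' (ltnW (ltn_ord x)).
have Ex : (x \in M) = (x \in M').
  by move: E; case: (x \in M); case: (x \in M'); lia.
move=> y; rewrite ltnS leq_eqVlt => /orP[/eqP/val_inj->//|]; apply: IH.
by move: E; rewrite Ex => /addIn.
Qed.

(** The successor of the counter [M] when [x] is its lowest zero digit: lower digits are cleared and
    higher ones kept. *)
Definition incr_mask M (x : 'I_n) : {set 'I_n} := x |: [set y in M | x < y].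

Lemma weight_incr A M (x : 'I_n) : M \subset A -> x \in A -> x \notin M ->
  (forall y : 'I_n, y < x -> y \in A -> y \in M) ->
  weight A (incr_mask M x) n = (weight A M n).+1.
Proof.
move=> sMA xA xM low.
(* Up to [x] the old counter is all ones and the new one all zeros; the carry is the digit at
   [x]. *)
have ones i : i <= n -> i <= x -> (weight A M i).+1 = 2 ^ rank A i
    /\ weight A (incr_mask M x) i = 0.
  move: i; apply: prefix_ind => [|y IH] yx.
    by rewrite /weight /rank !prefix_sum0.
  have [E1 E2] := IH (ltnW yx).
  rewrite /weight /rank !prefix_sumS -!/(rank _ _) -!/(weight _ _ _) expnD E2 -E1.
  have -> : (y \in incr_mask M x) = false.
    by rewrite !inE -val_eqE /= ltn_eqF // ltnNge (ltnW yx) andbF.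
  have -> : (y \in A) = (y \in M).
    by apply/idP/idP; [apply: low | apply: (subsetP sMA)].
  by case: (y \in M); rewrite /=; lia.
suff H i : i <= n -> x < i -> weight A (incr_mask M x) i = (weight A M i).+1.
  by apply: H.
move: i; apply: prefix_ind => [//|y IH]; rewrite ltnS leq_eqVlt.
rewrite /weight !prefix_sumS -!/(weight _ _ _).
case/orP=> [/eqP/val_inj <-|xy]; last first.
  by rewrite (IH xy) !inE xy andbT -val_eqE /= gtn_eqF.
have [<- ->] := ones x (ltnW (ltn_ord x)) (leqnn x).
by rewrite (negPf xM) !inE eqxx /=; lia.
Qed.
End PrefixSums.

(** * The program *)

Local Notation rJobs := 0 (only parsing).
Local Notation rArcs := 1 (only parsing).
Local Notation rMachines := 2 (only parsing).
Local Notation rTarget := 3 (only parsing).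
Local Notation rFound := 4 (only parsing).
Local Notation rRec := 5 (only parsing).
Local Notation rEnd := 6 (only parsing).
Local Notation rRound := 7 (only parsing).
Local Notation rIdx := 8 (only parsing).
Local Notation rSize := 9 (only parsing).
Local Notation rCode := 10 (only parsing).
Local Notation rSlot := 11 (only parsing).
Local Notation rAvail := 12 (only parsing).
Local Notation rCount := 13 (only parsing).
Local Notation rKey := 14 (only parsing).
Local Notation rDest := 15 (only parsing).
Local Notation rBest := 16 (only parsing).
Local Notation rTime := 17 (only parsing).
Local Notation rMach := 18 (only parsing).
Local Notation rLeft := 19 (only parsing).
Local Notation rMaxRel := 20 (only parsing).
Local Notation rBound := 21 (only parsing).
Local Notation rGo := 22 (only parsing).

Local Notation aRel := 0 (only parsing).
Local Notation aTail := 1 (only parsing).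
Local Notation aHead := 2 (only parsing).
Local Notation aSel := 3 (only parsing).
Local Notation aMach := 4 (only parsing).
Local Notation aSlot := 5 (only parsing).
Local Notation aPow := 6 (only parsing).
Local Notation aDict := 7 (only parsing).
Local Notation aEnd := 8 (only parsing).
Local Notation aIn := 9 (only parsing).
Local Notation aRecSlot := 10 (only parsing).
Local Notation aRecMach := 11 (only parsing).
Local Notation aFree := 12 (only parsing).
Local Notation aMask := 13 (only parsing).

Declare Scope prog_scope.
Delimit Scope prog_scope with prog.
Local Notation "c1 ;; c2" := (CSeq c1 c2) (at level 60, right associativity) : prog_scope.
Local Notation "x ::= e" := (CAssign x e) (at level 55) : prog_scope.
Local Open Scope prog_scope.

Definition incr x := x ::= EAdd (EReg x) (EConst 1).
Definition rec_cell := EAdd (EReg rRec) (EReg rIdx).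

(** [aFree] is narrowed in place: to the complement of [Q] here, to the enabled jobs by [block], and
    to the available jobs by [filter_avail]. *)
Definition scan : cmd :=
  (rSize ::= EConst 0;; rCode ::= EConst 0);;
  CFor rIdx rJobs
    (CIf (TEq (EGet aIn rec_cell) (EConst 1))
       (CStore aFree (EReg rIdx) (EConst 0);; incr rSize;;
        rCode ::= EAdd (EReg rCode) (EGet aPow (EReg rIdx)))
       (CStore aFree (EReg rIdx) (EConst 1))).

Definition block : cmd :=
  CFor rIdx rArcs
    (CIf (TEq (EGet aIn (EAdd (EReg rRec) (EGet aTail (EReg rIdx)))) (EConst 0))
       (CStore aFree (EGet aHead (EReg rIdx)) (EConst 0))
       CSkip).

(** The least release date of an enabled job, raised to one after the end of the record if
    necessary. The largest release date is a safe start value for the minimum. *)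
Definition find_slot : cmd :=
  rSlot ::= EReg rMaxRel;;
  CFor rIdx rJobs
    (CIf (TAnd (TEq (EGet aFree (EReg rIdx)) (EConst 1))
               (TLe (EGet aRel (EReg rIdx)) (EReg rSlot)))
       (rSlot ::= EGet aRel (EReg rIdx)) CSkip);;
  CIf (TLe (EReg rSlot) (EGet aEnd (EReg rRec)))
    (rSlot ::= EAdd (EGet aEnd (EReg rRec)) (EConst 1)) CSkip.

Definition filter_avail : cmd :=
  rAvail ::= EConst 0;;
  CFor rIdx rJobs
    (CIf (TAnd (TEq (EGet aFree (EReg rIdx)) (EConst 1))
               (TLe (EGet aRel (EReg rIdx)) (EReg rSlot)))
       (incr rAvail)
       (CStore aFree (EReg rIdx) (EConst 0))).

(** Replaces division: started at slot [s] and machine 0, [rTime] and [rMach] follow the quotient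
    and the remainder by [m] of the number of ticks. *)
Definition tick : cmd :=
  incr rMach;;
  CIf (TEq (EReg rMach) (EReg rMachines)) (rMach ::= EConst 0;; incr rTime) CSkip.

Definition fill : cmd :=
  CFor rIdx rJobs
    (CIf (TAnd (TEq (EGet aFree (EReg rIdx)) (EConst 1))
               (TLe (EConst 1) (EReg rLeft)))
       ((CStore aSel (EReg rIdx) (EConst 1);;
         CStore aMach (EReg rIdx) (EReg rMach);;
         CStore aSlot (EReg rIdx) (EReg rTime);;
         rLeft ::= ESub (EReg rLeft) (EConst 1));;
        tick)
       (CStore aSel (EReg rIdx) (EGet aIn rec_cell);;
        CStore aMach (EReg rIdx) (EGet aRecMach rec_cell);;
        CStore aSlot (EReg rIdx) (EGet aRecSlot rec_cell))).

(** The loop only runs the clock up to the last of the [k - #|Q|] jobs. The output arrays are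
    overwritten only if nothing was found before or the resulting makespan is strictly smaller. *)
Definition finish : cmd :=
  (rLeft ::= ESub (EReg rTarget) (EReg rSize);;
   rBound ::= ESub (EReg rLeft) (EConst 1);;
   rTime ::= EReg rSlot;; rMach ::= EConst 0);;
  CFor rIdx rBound tick;;
  CIf (TAnd (TEq (EReg rFound) (EConst 1)) (TLe (EReg rBest) (EReg rTime))) CSkip
    ((rFound ::= EConst 1;; rBest ::= EReg rTime;;
      rTime ::= EReg rSlot;; rMach ::= EConst 0);;
     fill).

Definition measure_mask : cmd :=
  (rCount ::= EConst 0;; rKey ::= EReg rCode);;
  CFor rIdx rJobs
    (CIf (TEq (EGet aMask (EReg rIdx)) (EConst 1))
       (incr rCount;; rKey ::= EAdd (EReg rKey) (EGet aPow (EReg rIdx)))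
       CSkip).

Definition dest_cell := EAdd (EReg rDest) (EReg rIdx).

Definition write_rec : cmd :=
  (CStore aEnd (EReg rDest) (EReg rSlot);; rCount ::= EConst 0);;
  CFor rIdx rJobs
    (CIf (TEq (EGet aMask (EReg rIdx)) (EConst 1))
       (CStore aIn dest_cell (EConst 1);;
        CStore aRecSlot dest_cell (EReg rSlot);;
        CStore aRecMach dest_cell (EReg rCount);;
        incr rCount)
       (CStore aIn dest_cell (EGet aIn rec_cell);;
        CStore aRecSlot dest_cell (EGet aRecSlot rec_cell);;
        CStore aRecMach dest_cell (EGet aRecMach rec_cell))).

(* [aDict] maps the code of a recorded set to 1 + the first cell of its record;
   0 means that the set is not recorded. *)
Definition lookup : cmd :=
  CIf (TEq (EGet aDict (EReg rKey)) (EConst 0))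
    (CStore aDict (EReg rKey) (EAdd (EReg rEnd) (EConst 1));;
     CStore aEnd (EReg rEnd) (EAdd (EReg rSlot) (EConst 1));;
     rEnd ::= EAdd (EReg rEnd) (EReg rJobs))
    CSkip;;
  rDest ::= ESub (EGet aDict (EReg rKey)) (EConst 1).

(** A record just created by [lookup] carries the placeholder end [rSlot + 1], so the comparison
    always lets it be filled. *)
Definition upsert : cmd :=
  lookup;;
  CIf (TLe (EAdd (EReg rSlot) (EConst 1)) (EGet aEnd (EReg rDest)))
    write_rec CSkip.

(* Increment of a binary counter whose digits are the available jobs. *)
Definition next_mask : cmd :=
  rIdx ::= EConst 0;;
  CWhile (TAnd (TLe (EAdd (EReg rIdx) (EConst 1)) (EReg rJobs))
               (TNot (TAnd (TEq (EGet aFree (EReg rIdx)) (EConst 1))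
                           (TEq (EGet aMask (EReg rIdx)) (EConst 0)))))
    (CStore aMask (EReg rIdx) (EConst 0);; incr rIdx).

Definition try_mask : cmd :=
  measure_mask;; CIf (TLe (EReg rCount) (EReg rMachines)) upsert CSkip.

(** Incrementing before trying skips the empty set; overflow of the counter ends the enumeration. *)
Definition next_subset : cmd :=
  next_mask;;
  CIf (TLe (EReg rJobs) (EReg rIdx)) (rGo ::= EConst 0)
    (CStore aMask (EReg rIdx) (EConst 1);; try_mask).

Definition enumerate : cmd :=
  CFor rIdx rJobs (CStore aMask (EReg rIdx) (EConst 0));;
  rGo ::= EConst 1;;
  CWhile (TEq (EReg rGo) (EConst 1)) next_subset.

Definition expand : cmd :=
  scan;; block;; find_slot;; filter_avail;;
  CIf (TLe (EReg rTarget) (EAdd (EReg rSize) (EReg rAvail))) finish enumerate.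

Definition pass : cmd :=
  rRec ::= EConst 0;;
  CWhile (TLe (EAdd (EReg rRec) (EConst 1)) (EReg rEnd))
    (expand;; rRec ::= EAdd (EReg rRec) (EReg rJobs)).

Definition init_powers : cmd :=
  rKey ::= EConst 1;;
  CFor rIdx rJobs
    (CStore aPow (EReg rIdx) (EReg rKey);; rKey ::= EAdd (EReg rKey) (EReg rKey)).

Definition init_bounds : cmd :=
  (rSlot ::= EGet aRel (EConst 0);; rMaxRel ::= EGet aRel (EConst 0));;
  CFor rIdx rJobs
    (CIf (TLe (EGet aRel (EReg rIdx)) (EReg rSlot))
       (rSlot ::= EGet aRel (EReg rIdx)) CSkip;;
     CIf (TLe (EReg rMaxRel) (EGet aRel (EReg rIdx)))
       (rMaxRel ::= EGet aRel (EReg rIdx)) CSkip).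

(* Code 0 is that of the empty set, whose record is number 0. *)
Definition init_store : cmd :=
  CStore aEnd (EConst 0) (ESub (EReg rSlot) (EConst 1));;
  CStore aDict (EConst 0) (EConst 1);; rEnd ::= EReg rJobs.

Definition main : cmd :=
  CIf (TLe (EReg rTarget) (EConst 0)) (rFound ::= EConst 1)
    (CIf (TAnd (TLe (EReg rTarget) (EReg rJobs)) (TLe (EConst 1) (EReg rMachines)))
       ((init_powers;; init_bounds;; init_store);; CFor rRound rTarget pass)
       CSkip).

(** * Correctness and running time *)

Section Correctness.
Variable I : instance.
Local Notation V := 'I_(jobs I).
Local Notation r := (@release I).
Local Notation m := (machines I).
Local Notation k := (target I).
Local Notation n := (jobs I).
Local Notation E := (size (arcs I)).
Local Notation arcn := (tnth (in_tuple (arcs I))).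
Implicit Types (Q M A : {set V}) (s t : int) (st : state) (qs : seq {set V}).

(** Relative to the full set a job's rank is its index, so this is the sum of [2 ^ j] over [j] in
    [Q]. *)
Definition code Q := weight [set: V] Q n.

(** The part of the state that is never written after initialisation. *)
Record env st : Prop := Env {
  env_jobs : reg st rJobs = Posz n;
  env_arcs : reg st rArcs = Posz E;
  env_machines : reg st rMachines = Posz m;
  env_target : reg st rTarget = Posz k;
  env_maxrel : forall j, (r j <= reg st rMaxRel)%R;
  env_rel : forall j : V, arr st aRel (Posz j) = r j;
  env_tail : forall e : 'I_E, arr st aTail (Posz e) = Posz (arcn e).1;
  env_head : forall e : 'I_E, arr st aHead (Posz e) = Posz (arcn e).2;
  env_pow : forall j : V, arr st aPow (Posz j) = Posz (2 ^ rank [set: V] j)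
}.

Lemma env_unchanged c st st' : unchanged c st st' ->
  ~~ has [in [:: rJobs; rArcs; rMachines; rTarget; rMaxRel]] (mod_regs c) &&
  ~~ has [in [:: aRel; aTail; aHead; aPow]] (mod_arrs c) -> env st -> env st'.
Proof.
case=> U1 U2 /andP[/hasPn H1 /hasPn H2] e.
have R x : x \in [:: rJobs; rArcs; rMachines; rTarget; rMaxRel] ->
    reg st' x = reg st x.
  by move=> xin; apply: U1; apply: contraTN xin => /H1.
have A a i : a \in [:: aRel; aTail; aHead; aPow] -> arr st' a i = arr st a i.
  by move=> ain; apply: U2; apply: contraTN ain => /H2.
split=> *; rewrite ?R ?A //; [exact: env_jobs | exact: env_arcs
  | exact: env_machines | exact: env_target | exact: env_maxrel | exact: env_rel
  | exact: env_tail | exact: env_head | exact: env_pow].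
Qed.

(** * Analysing a record: available jobs and the branching slot *)

Lemma cellE (x y : V) : (Posz x == Posz y) = (x == y).
Proof. by rewrite eqz_nat. Qed.

Lemma ltn_succ_neq (x y : V) : x < y.+1 -> x != y -> x < y.
Proof. by rewrite ltnS leq_eqVlt -val_eqE => /orP[->|]. Qed.

(** As in the later specifications, [kb] is an upper bound on the cost of the loop body and the
    constants of the total are rounded up generously. *)
Lemma scan_spec st p Q : env st -> reg st rRec = Posz p ->
  (forall j : V, arr st aIn (Posz (p + j)) = Posz (j \in Q)) ->
  runs scan st (100 * n + 100) (fun st' =>
    [/\ forall j : V, arr st' aFree (Posz j) = Posz (j \notin Q),
        reg st' rSize = Posz #|Q|, reg st' rCode = Posz (code Q)
      & unchanged scan st st']).
Proof.
move=> e Ep EQ.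
pose Inv i st' := [/\ forall j : V, j < i ->
    arr st' aFree (Posz j) = Posz (j \notin Q),
  reg st' rSize = Posz (rank Q i) & reg st' rCode = Posz (weight [set: V] Q i)].
apply: runs_weak (runs_unchanged (runs_seq_straight _
  (runs_for (Inv := Inv) (n := n) (kb := 22) _ _ _ _))) _ _ => //.
- by rewrite /= (env_jobs e).
- by split=> //=; rewrite /rank /weight prefix_sum0.
- move=> x st' Ex U [IF IS IC].
  apply: runs_weak (runs_straight _ _) _ (fun st2 H => H) => //.
  have Er := U.1 rRec isT; rewrite /= Ep in Er.
  have EI := U.2 aIn _ isT; have EP := U.2 aPow _ isT; rewrite /= in EI EP.
  rewrite /= Er Ex [(_ + _)%R](_ : _ = Posz (p + x)) // EI EQ.
  case: (boolP (x \in Q)) => xQ; split=> /=.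
  + move=> j jx; rewrite cellE; case: eqVneq => [->|ne]; first by rewrite ?xQ ?(negPf xQ).
    exact/IF/ltn_succ_neq.
  + by rewrite IS /rank prefix_sumS xQ.
  + by rewrite IC EP (env_pow e) /weight prefix_sumS xQ mul1n.
  + move=> j jx; rewrite cellE; case: eqVneq => [->|ne]; first by rewrite ?xQ ?(negPf xQ).
    exact/IF/ltn_succ_neq.
  + by rewrite IS /rank prefix_sumS (negPf xQ) addn0.
  + by rewrite IC /weight prefix_sumS (negPf xQ) mul0n addn0.
- by move: n => n'; rewrite /=; lia.
- by move=> st' [[[IF IS IC] _] U]; split=> //; [move=> j; apply: IF | rewrite -rank_total].
Qed.

Lemma block_spec st p Q : env st -> reg st rRec = Posz p ->
  (forall j : V, arr st aIn (Posz (p + j)) = Posz (j \in Q)) ->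
  (forall j : V, arr st aFree (Posz j) = Posz (j \notin Q)) ->
  runs block st (100 * E + 100) (fun st' =>
    (forall j : V, arr st' aFree (Posz j) = Posz (j \in enabled Q)) /\
    unchanged block st st').
Proof.
move=> e Ep EQ EF.
pose Inv i st' := forall j : V, arr st' aFree (Posz j) =
  Posz ((j \notin Q) && all (fun a => (a.2 == j) ==> (a.1 \in Q)) (take i (arcs I))).
apply: runs_weak (runs_for (Inv := Inv) (n := E) (kb := 13) _ _ _ _) _ _ => //.
- exact: env_arcs.
- by move=> j; rewrite take0 /= EF andbT.
- move=> x st' Ex U IF.
  apply: runs_weak (runs_straight _ _) _ (fun st2 H => H) => //.
  have Er := U.1 rRec isT; rewrite Ep in Er.
  rewrite /= Er Ex (U.2 aTail _ isT) (U.2 aIn _ isT) (env_tail e) EQ.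
  rewrite (U.2 aHead _ isT) (env_head e) => {Er U}.
  have tk : take x.+1 (arcs I) = rcons (take x (arcs I)) (arcn x).
    by rewrite (take_nth (arcn x)) //; congr rcons; rewrite [RHS](tnth_nth (arcn x)).
  case: (arcn x) tk => a b tk /=; rewrite /Inv tk.
  case: (boolP (a \in Q)) => aQ j /=; rewrite all_rcons /= ?aQ ?implybT ?IF //.
  rewrite cellE eq_sym (negPf aQ) implybF; by case: eqVneq => _ //=; rewrite andbF.
- by move: E => n'; rewrite /=; lia.
- move=> st' [IF U]; split=> // j; rewrite IF take_size; congr (Posz (nat_of_bool _)).
  rewrite inE; congr (_ && _); apply/allP/forallP => [H a|H [a b] ab /=].
    by apply/implyP=> aj; have /implyP := H _ aj; apply; apply: eqxx.
  by apply/implyP=> /eqP E; rewrite E in ab; have /implyP := H a; apply.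
Qed.

Lemma find_slot_spec st p Q t : env st -> reg st rRec = Posz p ->
  arr st aEnd (Posz p) = t ->
  (forall j : V, arr st aFree (Posz j) = Posz (j \in enabled Q)) ->
  #|Q| < n ->
  runs find_slot st (100 * n + 100) (fun st' =>
    next_slot Q t (reg st' rSlot) /\ unchanged find_slot st st').
Proof.
move=> e Ep Et EF /exists_enabled[j0 j0E]; apply: runs_unchanged.
pose Inv i st' :=
  (forall j : V, j < i -> j \in enabled Q -> (reg st' rSlot <= r j)%R) /\
  (exists2 j, j \in enabled Q & (r j <= reg st' rSlot)%R).
apply: runs_weak (runs_seq_straight _ (runs_seq (n2 := 10)
  (runs_for (Inv := Inv) (n := n) (kb := 14) _ _ _ _) _)) _ (fun st2 H => H).
- by [].
- by [].
- by rewrite /= (env_jobs e).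
- by split=> //; exists j0 => //=; apply: env_maxrel.
- move=> x st' Ex U [Ilo Iex].
  apply: runs_weak (runs_straight _ _) _ (fun st2 H => H) => //.
  have EF' := U.2 aFree _ isT; have ER := U.2 aRel _ isT; rewrite /= in EF' ER.
  rewrite /= Ex EF' EF ER (env_rel e) => {EF' ER U}.
  have -> : (Posz (x \in enabled Q) == 1) = (x \in enabled Q) by case: (_ \in _).
  case: ifPn => [/andP[xE le]|nle]; split=> //=.
  + move=> j jx jE; have [-> //|ne] := eqVneq j x.
    by apply: le_trans le (Ilo _ (ltn_succ_neq jx ne) jE).
  + by exists x.
  + move=> j jx jE; have [Ej|ne] := eqVneq j x; last exact: Ilo (ltn_succ_neq jx ne) jE.
    by subst j; rewrite jE /= -ltNge in nle; apply: ltW.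
- move=> st1 [[Ilo [j1 j1E j1le]] U].
  apply: runs_weak (runs_straight _ _) _ (fun st2 H => H) => //.
  have EE := U.2 aEnd (Posz p) isT; have Er := U.1 rRec isT.
  rewrite /= ?Et ?Ep in EE Er; rewrite /= Er EE.
  case: ifPn => [le|]; [|rewrite -ltNge => lt]; split=> //=.
  + by lia.
  + by move=> j _; left.
  + by exists j1; rewrite inE j1E /=; lia.
  + by move=> j jE; right; apply: Ilo.
  + by exists j1; rewrite inE j1E.
- by move: n => n'; rewrite /=; lia.
Qed.

Lemma filter_avail_spec st s Q : env st -> reg st rSlot = s ->
  (forall j : V, arr st aFree (Posz j) = Posz (j \in enabled Q)) ->
  runs filter_avail st (100 * n + 100) (fun st' =>
    [/\ forall j : V, arr st' aFree (Posz j) = Posz (j \in avail Q s),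
        reg st' rAvail = Posz #|avail Q s| & unchanged filter_avail st st']).
Proof.
move=> e Es EF.
pose Inv i st' :=
  (forall j : V, arr st' aFree (Posz j) =
     Posz (j \in if j < i then avail Q s else enabled Q)) /\
  reg st' rAvail = Posz (rank (avail Q s) i).
apply: runs_weak (runs_unchanged (runs_seq_straight _
  (runs_for (Inv := Inv) (n := n) (kb := 14) _ _ _ _))) _ _ => //.
- by rewrite /= (env_jobs e).
- by split=> [j|] /=; rewrite ?EF // /rank prefix_sum0.
- move=> x st' Ex U [IF IA].
  apply: runs_weak (runs_straight _ _) _ (fun st2 H => H) => //.
  have ER := U.2 aRel (Posz x) isT; have ES := U.1 rSlot isT.
  rewrite /= (env_rel e) Es in ER ES.
  rewrite /= Ex IF ltnn ER ES => {U}.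
  have -> : (Posz (x \in enabled Q) == 1) = (x \in enabled Q) by case: (_ \in _).
  have -> : (x \in enabled Q) && (r x <= s)%R = (x \in avail Q s) by rewrite [RHS]inE.
  have upd (j : V) : j != x -> (j < x.+1) = (j < x).
    by move=> ne; rewrite ltnS leq_eqVlt val_eqE (negPf ne).
  case: (boolP (x \in avail Q s)) => xA; split=> /=.
  + move=> j; rewrite IF; have [->|ne] := eqVneq j x; last by rewrite upd.
    by rewrite ltnn ltnSn xA; move: xA; rewrite inE => /andP[->].
  + by rewrite IA /rank prefix_sumS xA.
  + move=> j; rewrite cellE; case: eqVneq => [->|ne]; last by rewrite IF upd.
    by rewrite ltnSn (negPf xA).
  + by rewrite IA /rank prefix_sumS (negPf xA) addn0.
- by move: n => n'; rewrite /=; lia.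
- move=> st' [[[IF IA] _] U]; split=> // [j|]; first by rewrite IF ltn_ord.
  by rewrite IA rank_total.
Qed.

(** * Greedy filling when enough jobs are available *)

Definition clock s x st :=
  reg st rTime = (s + Posz (x %/ m))%R /\ reg st rMach = Posz (x %% m).

Lemma clock0 s st : reg st rTime = s -> reg st rMach = 0 -> clock s 0 st.
Proof. by move=> E1 E2; split; rewrite ?div0n ?mod0n ?E1 ?addr0. Qed.

Lemma clock_tick s x st : 0 < m -> reg st rMachines = Posz m ->
  clock s x st -> clock s x.+1 (sem tick st).
Proof.
move=> m0 Em [Et Ec]; have lt : x %% m < m by rewrite ltn_mod.
have := divn_eq x m; rewrite /= Ec Em; move: (x %/ m) (x %% m) lt Et Ec => q c lt Et Ec Ex.
have [E|ne] := eqVneq (Posz c + 1)%R (Posz m).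
  have -> : x.+1 = q.+1 * m by rewrite mulSn; lia.
  by split; rewrite /= ?mulnK ?modnMl ?Et //; lia.
have -> : x.+1 = q * m + c.+1 by lia.
by split; rewrite /= ?divnMDl ?modnMDl ?divn_small ?modn_small ?Et //; lia.
Qed.

Lemma fill_spec st p Q A s c :
  env st -> 0 < m -> reg st rRec = Posz p ->
  (forall j : V, arr st aFree (Posz j) = Posz (j \in A)) ->
  (forall j : V, arr st aIn (Posz (p + j)) = Posz (j \in Q)) ->
  reg st rLeft = Posz c -> clock s 0 st ->
  runs fill st (100 * n + 100) (fun st' =>
    forall j : V, if (j \in A) && (rank A j < c)
      then [/\ arr st' aSel (Posz j) = 1, arr st' aMach (Posz j) = Posz (rank A j %% m)
             & arr st' aSlot (Posz j) = (s + Posz (rank A j %/ m))%R]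
      else [/\ arr st' aSel (Posz j) = Posz (j \in Q),
               arr st' aMach (Posz j) = arr st aRecMach (Posz (p + j))
             & arr st' aSlot (Posz j) = arr st aRecSlot (Posz (p + j))]).
Proof.
move=> e m0 Ep EF EI El Ec.
pose Done st' (j : V) := if (j \in A) && (rank A j < c)
      then [/\ arr st' aSel (Posz j) = 1, arr st' aMach (Posz j) = Posz (rank A j %% m)
             & arr st' aSlot (Posz j) = (s + Posz (rank A j %/ m))%R]
      else [/\ arr st' aSel (Posz j) = Posz (j \in Q),
               arr st' aMach (Posz j) = arr st aRecMach (Posz (p + j))
             & arr st' aSlot (Posz j) = arr st aRecSlot (Posz (p + j))].
(* So far [minn (rank A i) c] jobs have been placed, with one tick each. *)
pose Inv i st' := [/\ forall j : V, j < i -> Done st' j,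
  reg st' rLeft = Posz (c - minn (rank A i) c) & clock s (minn (rank A i) c) st'].
apply: runs_weak (runs_for (Inv := Inv) (n := n) (kb := 49) _ _ _ _) _ _ => //.
- exact: env_jobs.
- by split=> //=; rewrite /rank prefix_sum0 min0n ?subn0.
- move=> x st' Ex U [ID IL IC].
  have Er := U.1 rRec isT; rewrite Ep in Er.
  have Em := U.1 rMachines isT; rewrite (env_machines e) in Em.
  have guard : (Posz (x \in A) == 1) && (1 <= Posz (c - minn (rank A x) c))%R =
            (x \in A) && (rank A x < c).
    by case: (x \in A) => //=; lia.
  have old st2 : (forall j : V, j != x -> [/\ arr st2 aSel (Posz j) = arr st' aSel (Posz j),
      arr st2 aMach (Posz j) = arr st' aMach (Posz j)
      & arr st2 aSlot (Posz j) = arr st' aSlot (Posz j)]) -> Done st2 x ->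
      forall j : V, j < x.+1 -> Done st2 j.
    move=> H Dx j jx; have [-> //|ne] := eqVneq j x.
    have [h1 h2 h3] := H _ ne; have := ID _ (ltn_succ_neq jx ne).
    by rewrite /Done h1 h2 h3.
  apply: runs_weak (runs_if (n := 40) _) _ (fun st2 H => H) => //.
  rewrite [holds _ _]/= Ex (U.2 aFree _ isT) EF IL guard.
  case: (boolP ((x \in A) && (rank A x < c))) => [xAc|nx].
    have /andP[xA xc] := xAc.
    have Erk : minn (rank A x.+1) c = (minn (rank A x) c).+1.
      by rewrite /rank prefix_sumS xA -/(rank _ _); lia.
    have Emin : minn (rank A x) c = rank A x by lia.
    apply: runs_weak (runs_seq_straight _ (runs_straight (c := tick) _ _)) _
      (fun st2 H => H) => //.
    set st5 := sem _ st'.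
    have [R5 A5] := sem_unchanged st5 (isT : straight tick).
    have [Et' Ec'] := IC; have C5 : clock s (minn (rank A x) c) st5 by [].
    have := @clock_tick _ _ st5 m0 Em C5; rewrite -Erk => C6; split.
    - apply: old => [j ne|]; last rewrite /Done xAc; split=> /=;
        rewrite A5 //= Ex cellE ?(negPf ne) // eqxx //=.
        by rewrite Ec' Emin.
      by rewrite Et' Emin.
    - by rewrite [reg _ _]/= R5 //= IL Erk; lia.
    - exact: C6.
  have Erk : minn (rank A x.+1) c = minn (rank A x) c.
    by move: nx; rewrite /rank prefix_sumS -/(rank _ _); case: (x \in A) => /=; lia.
  apply: runs_weak (runs_straight _ _) _ (fun st2 H => H) => //.
  rewrite [sem _ _]/= Er Ex; split; rewrite ?Erk //.
  have cellp : (Posz p + Posz x)%R = Posz (p + x) by [].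
  apply: old => [j ne|]; last rewrite /Done (negPf nx); split=> /=;
    rewrite cellE ?(negPf ne) // eqxx cellp.
  + by rewrite (U.2 aIn _ isT) EI.
  + by rewrite (U.2 aRecMach _ isT).
  + by rewrite (U.2 aRecSlot _ isT).
- by move: n => n'; rewrite /=; lia.
- by move=> st' [[ID _ _] _] j; apply: ID.
Qed.

Lemma eq_partial_schedule Q t (f g f' g' : V -> int) :
  partial_schedule Q t f g -> f =1 f' -> g =1 g' -> partial_schedule Q t f' g'.
Proof.
by case=> h1 h2 h3 h4 Ef Eg; split=> [j|j|i j|a b]; rewrite -?Ef -?Eg;
   [apply: h1 | apply: h2 | apply: h3 | apply: h4].
Qed.

(** Soundness invariant of the whole run: whatever is marked as found is a genuine schedule ending
    by [rBest]. *)
Definition output st : Prop :=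
  reg st rFound = 0 \/
  reg st rFound = 1 /\ exists Q, [/\ k <= #|Q|,
    forall j : V, arr st aSel (Posz j) = Posz (j \in Q)
    & partial_schedule Q (reg st rBest)
        (fun j => arr st aSlot (Posz j)) (fun j => arr st aMach (Posz j))].

Definition found_by C st := reg st rFound = 1 /\ (reg st rBest <= C)%R.

(** The time reached equals the lower bound of [completable_slots], so the record needs no further
    branching. *)
Lemma finish_spec st p t s Q :
  env st -> 0 < m -> #|Q| < k -> reg st rRec = Posz p ->
  (forall j : V, arr st aIn (Posz (p + j)) = Posz (j \in Q)) ->
  partial_schedule Q t (fun j => arr st aRecSlot (Posz (p + j)))
    (fun j => arr st aRecMach (Posz (p + j))) ->
  reg st rSize = Posz #|Q| -> reg st rSlot = s -> (t < s)%R ->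
  (forall j : V, arr st aFree (Posz j) = Posz (j \in avail Q s)) ->
  k <= #|Q| + #|avail Q s| -> k <= n -> output st ->
  runs finish st (200 * n + 200) (fun st' =>
    [/\ output st', found_by (s + Posz ((k - #|Q|).-1 %/ m))%R st',
        forall C, found_by C st -> found_by C st' & unchanged finish st st']).
Proof.
move=> e m0 ltQ Ep EI PS Esz Es lt_ts EF lek lekn out.
set c := k - #|Q|; set A := avail Q s in EF lek *.
set f := (s + _)%R.
suff H : runs finish st (200 * n + 200) (fun st' =>
    [/\ output st', found_by f st' & forall C, found_by C st -> found_by C st']).
  by apply: runs_weak (runs_unchanged H) _ _ => // st' [[]].
pose Inv i st' := clock s i st'.
apply: runs_weak (runs_seq_straight _ (runs_seq (n2 := 110 * n + 130)
  (runs_for (Inv := Inv) (n := c.-1) (kb := 16) _ _ _ _) _)) _ (fun st2 H => H).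
- by [].
- by [].
- by rewrite /= (env_target e) Esz; lia.
- by apply: clock0.
- move=> x st' Ex U Ic.
  apply: runs_weak (runs_straight _ _) _ (fun st2 H => H) => //.
  apply: clock_tick => //; have := U.1 rMachines isT => /= ->; exact: env_machines.
- move=> st1 [[Et Ec] U1].
  have Ef1 := U1.1 rFound isT; have Eb1 := U1.1 rBest isT; rewrite /= in Ef1 Eb1.
  apply: runs_weak (runs_if (n := 110 * n + 120) _) _ (fun st2 H => H); last by rewrite /=; lia.
  rewrite [holds _ _]/= Et Ef1 Eb1 -/f; case: ifPn => [/andP[/eqP E1 le]|nle].
    apply: runs_weak (runs_straight _ _) _ (fun st2 H => H); [by [] | | by rewrite /=; lia].
    split.
    + case: out => [|[_ [Q' [h1 h2 h3]]]]; first by rewrite E1.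
      right; rewrite /= Ef1 Eb1; split=> //; exists Q'; split=> //.
        by move=> j; have := U1.2 aSel (Posz j) isT => /= ->.
      apply: eq_partial_schedule h3 _ _ => j.
        by have := U1.2 aSlot (Posz j) isT => /= ->.
      by have := U1.2 aMach (Posz j) isT => /= ->.
    + by split; rewrite /= ?Ef1 ?Eb1.
    + by move=> C [h1 h2]; split; rewrite /= ?Ef1 ?Eb1.
  have [h1 h2 h3] : [/\ forall j : V, arr st1 aFree (Posz j) = Posz (j \in A),
      forall j : V, arr st1 aIn (Posz (p + j)) = Posz (j \in Q) & env st1].
    split=> [j|j|]; [by have := U1.2 aFree (Posz j) isT => /= ->
      | by have := U1.2 aIn (Posz (p + j)) isT => /= -> |].
    by apply: (env_unchanged U1 isT); case: e; split.
  have El := U1.1 rLeft isT; have Er := U1.1 rRec isT; have Esl := U1.1 rSlot isT.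
  rewrite /= (env_target e) Esz Ep Es in El Er Esl.
  apply: runs_weak (runs_seq_straight _ (runs_unchanged (fill_spec (p := p) (Q := Q) (A := A)
    (s := s) (c := c) _ m0 _ _ _ _ _))) _ _.
  + by [].
  + by case: h3; split.
  + by rewrite /= Er.
  + by move=> j; rewrite /= h1.
  + by move=> j; rewrite /= h2.
  + by rewrite /= El /c; lia.
  + by apply: clock0.
  + by rewrite /=; lia.
  move=> st3 [F3 U3]; have EB : reg st3 rBest = f.
    by have := U3.1 rBest isT => /= ->; rewrite Et.
  have EF3 : reg st3 rFound = 1 by have := U3.1 rFound isT => /= ->.
  split.
  + right; split=> //; pose N := [set x in A | rank A x < c].
    exists (Q :|: N).
    have sNE : N \subset enabled Q.
      by apply/subsetP=> x; rewrite !inE => /andP[/andP[]].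
    have NQ j : j \in Q -> (j \in A) && (rank A j < c) = false.
      by move=> jQ; rewrite !inE jQ.
    have old a j : a \in [:: aRecSlot; aRecMach] -> arr st1 a j = arr st a j.
      by rewrite !inE => /orP[] /eqP->;
        [have := U1.2 aRecSlot j isT | have := U1.2 aRecMach j isT].
    split.
    * rewrite (_ : #|Q :|: N| = #|Q| + #|N|).
        by rewrite card_rank_lt /c; lia.
      apply/eqP; rewrite (leq_card_setU Q N) disjoint_sym disjoints_subset.
      by apply/subsetP=> x /(subsetP sNE) /enabledP[xQ _]; rewrite inE.
    * move=> j; rewrite 2!inE; have := F3 j; case: ifP => [jN [-> _ _]|_ [-> _ _]].
        by rewrite orbT.
      by rewrite orbF.
    * apply: (partial_schedule_extend PS _ sNE).
      - by rewrite EB /f; move: (c.-1 %/ m) lt_ts => q; clear; lia.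
      - move=> j; rewrite inE => jN; have := F3 j; rewrite jN => -[_ _ ->].
        move: jN; rewrite EB /f => /andP[jA jc].
        have : rank A j %/ m <= c.-1 %/ m by apply: leq_div2r; lia.
        move: jA; rewrite inE => /andP[_]; move: (_ %/ m) (_ %/ m) lt_ts => q q'.
        by clear; move=> *; split; lia.
      - move=> j; rewrite inE => jN; have := F3 j; rewrite jN => -[_ -> _].
        by have := ltn_pmod (rank A j) m0; lia.
      - move=> x y; rewrite [x \in N]inE [y \in N]inE => xN yN; have := F3 x; have := F3 y.
        rewrite xN yN => -[_ -> ->] [_ -> ->] ed em.
        case/andP: xN yN => [xA _] /andP[yA _]; apply: (rank_inj xA yA).
        by rewrite (divn_eq (rank A x) m) (divn_eq (rank A y) m); lia.
      - move=> j jQ; have := F3 j; rewrite (NQ _ jQ) => -[_ -> ->] /=.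
        by rewrite !old.
  + by split; rewrite ?EB.
  + move=> C [C1 C2]; split=> //; rewrite EB; apply: le_trans C2.
    by move: nle; rewrite C1 /= -ltNge => /ltW.
by rewrite /=; lia.
Qed.

(** * Codes of sets, records and the table of records *)

Lemma codeU Q M : [disjoint Q & M] -> code (Q :|: M) = code Q + code M.
Proof.
move=> dis; rewrite /code /weight !prefix_sum_total -big_split; apply: eq_bigr => x _.
rewrite inE; case: (boolP (x \in Q)) => [xQ|_]; last by case: (x \in M).
by rewrite (disjointFr dis xQ) mul0n /= addn0.
Qed.

Lemma code_inj : injective code.
Proof. by move=> Q Q'; apply: weight_inj; apply: subsetT. Qed.

Lemma measure_mask_spec st Q M : env st -> reg st rCode = Posz (code Q) ->
  (forall j : V, arr st aMask (Posz j) = Posz (j \in M)) -> [disjoint Q & M] ->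
  runs measure_mask st (100 * n + 100) (fun st' =>
    [/\ reg st' rCount = Posz #|M|, reg st' rKey = Posz (code (Q :|: M))
      & unchanged measure_mask st st']).
Proof.
move=> e Ec EM dis.
pose Inv i st' := reg st' rCount = Posz (rank M i) /\
  reg st' rKey = Posz (code Q + weight [set: V] M i).
apply: runs_weak (runs_unchanged (runs_seq_straight _
  (runs_for (Inv := Inv) (n := n) (kb := 15) _ _ _ _))) _ _ => //.
- by rewrite /= (env_jobs e).
- by split; rewrite /= /rank /weight prefix_sum0 // addn0.
- move=> x st' Ex U [IC IK].
  apply: runs_weak (runs_straight _ _) _ (fun st2 H => H) => //.
  have EM' := U.2 aMask (Posz x) isT; have EP := U.2 aPow (Posz x) isT.
  rewrite /= EM (env_pow e) in EM' EP; rewrite /= Ex EM' EP.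
  case: (boolP (x \in M)) => xM; split=> /=.
  + by rewrite IC /rank prefix_sumS xM.
  + by rewrite IK /weight prefix_sumS xM mul1n addnA.
  + by rewrite IC /rank prefix_sumS (negPf xM) addn0.
  + by rewrite IK /weight prefix_sumS (negPf xM) mul0n addn0.
- by move: n => n'; rewrite /=; lia.
- move=> st' [[[IC IK] _] U]; split=> //; first by rewrite IC rank_total.
  (* Digits of disjoint sets add up without carries, so additions suffice to code the union. *)
  by rewrite codeU.
Qed.

(* Record number [i] occupies [n] consecutive cells. *)
Definition cell i (j : V) := Posz (i * n + j).

Lemma cell_inj i i' (j j' : V) : cell i j = cell i' j' -> i = i' /\ j = j'.
Proof.
case=> E; have n0 : 0 < n by apply: leq_ltn_trans (ltn_ord j).
have Ei : i = i'.
  have := congr1 (divn^~ n) E.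
  by rewrite !divnMDl // !divn_small // !addn0.
by split=> //; apply: val_inj; move: E; rewrite Ei => /addnI.
Qed.

Definition rec_end st i := arr st aEnd (Posz (i * n)).

Record row Q i st : Prop := Row {
  row_in : forall j : V, arr st aIn (cell i j) = Posz (j \in Q);
  row_ps : partial_schedule Q (rec_end st i)
    (fun j => arr st aRecSlot (cell i j)) (fun j => arr st aRecMach (cell i j))
}.

Lemma row_eq Q i st st' : row Q i st -> rec_end st' i = rec_end st i ->
  (forall a j, a \in [:: aIn; aRecSlot; aRecMach] ->
     arr st' a (cell i j) = arr st a (cell i j)) -> row Q i st'.
Proof.
move=> [h1 h2] Ee Ea; split=> [j|]; first by rewrite Ea.
by rewrite Ee; apply: eq_partial_schedule h2 _ _ => j; rewrite Ea.
Qed.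

Lemma write_rec_spec st i d s Q M : 0 < n -> env st -> reg st rRec = Posz (i * n) ->
  reg st rDest = Posz (d * n) -> i != d -> row Q i st -> (rec_end st i < s)%R ->
  reg st rSlot = s -> (forall j : V, arr st aMask (Posz j) = Posz (j \in M)) ->
  M \subset avail Q s -> #|M| <= m ->
  runs write_rec st (100 * n + 100) (fun st' =>
    [/\ row (Q :|: M) d st', rec_end st' d = s,
        forall Q' j, j != d -> rec_end st' j = rec_end st j /\
                               (row Q' j st -> row Q' j st')
      & unchanged write_rec st st']).
Proof.
move=> n0 e Er Ed ne [EQ PS] lt Es EM sM leM.
pose new st' (j : V) := [/\ arr st' aIn (cell d j) = Posz (j \in Q :|: M),
  arr st' aRecSlot (cell d j) = (if j \in M then s else arr st aRecSlot (cell i j))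
  & arr st' aRecMach (cell d j) =
    (if j \in M then Posz (rank M j) else arr st aRecMach (cell i j))].
pose Inv x st' := [/\ forall j : V, j < x -> new st' j,
  forall a z, (forall j, z <> cell d j) -> a \in [:: aIn; aRecSlot; aRecMach] ->
    arr st' a z = arr st a z & reg st' rCount = Posz (rank M x)].
(* The source row is disjoint from the target row, so it stays intact while being copied. *)
have idj j j' : cell i j <> cell d j'.
  by case/cell_inj => E; rewrite E eqxx in ne.
apply: runs_weak (runs_unchanged (runs_seq_straight _
  (runs_for (Inv := Inv) (n := n) (kb := 32) _ _ _ _))) _ _ => //.
- by rewrite /= (env_jobs e).
- split=> //=; last by rewrite /rank prefix_sum0.
  by move=> a z _; rewrite !inE => /or3P[] /eqP->.
- move=> x st' Ex U [IN IO IC].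
  apply: runs_weak (runs_straight _ _) _ (fun st2 H => H) => //.
  have Er' := U.1 rRec isT; have Ed' := U.1 rDest isT; have Es' := U.1 rSlot isT.
  have EM' := U.2 aMask (Posz x) isT; rewrite /= ?Er ?Ed ?Es ?EM in Er' Ed' Es' EM'.
  have cd : (Posz (d * n) + Posz x)%R = cell d x by [].
  have ci : (Posz (i * n) + Posz x)%R = cell i x by [].
  rewrite /= Er' Ed' Es' Ex EM' cd ci !IO //; try by move=> j; apply: idj.
  rewrite EQ.
  have other st2 : new st2 x -> (forall a z, z <> cell d x ->
       a \in [:: aIn; aRecSlot; aRecMach] -> arr st2 a z = arr st' a z) ->
      reg st2 rCount = Posz (rank M x.+1) -> Inv x.+1 st2.
    move=> Nx H Ec2; split=> // [j jx|a z nz ain].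
      have [-> //|nx] := eqVneq j x; have [h1 h2 h3] := IN _ (ltn_succ_neq jx nx).
      have nc : cell d j <> cell d x by case/cell_inj => _ E; rewrite E eqxx in nx.
      by split; rewrite H.
    by rewrite H //; apply: IO.
  case: (boolP (x \in M)) => xM; apply: other => /=.
  + by split; rewrite /= eqxx // ?inE xM ?orbT.
  + by move=> a z /eqP/negPf nz; rewrite !inE => /or3P[] /eqP-> /=; rewrite nz.
  + by rewrite IC /rank prefix_sumS xM.
  + by split; rewrite /= eqxx // ?(negPf xM) ?inE ?(negPf xM) ?orbF.
  + by move=> a z /eqP/negPf nz; rewrite !inE => /or3P[] /eqP-> /=; rewrite nz.
  + by rewrite IC /rank prefix_sumS (negPf xM) addn0.
- by move: n => n'; rewrite /=; lia.
move=> st' [[[IN IO IC] U'] U].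
have Een z : arr st' aEnd z = if z == Posz (d * n) then s else arr st aEnd z.
  by have := U'.2 aEnd z isT => /= ->; rewrite Ed Es.
have Ee : rec_end st' d = s by rewrite /rec_end Een eqxx.
have NQ j : j \in M -> j \in Q = false.
  by move/(subsetP sM); rewrite inE => /andP[/enabledP[/negPf]].
split=> //.
- split=> [j|]; first by case: (IN j (ltn_ord j)).
  rewrite Ee; apply: (partial_schedule_extend PS).
  + exact: ltW.
  + by apply: subset_trans sM _; apply/subsetP=> x; rewrite inE => /andP[].
  + move=> j jM; have [_ -> _] := IN j (ltn_ord j); rewrite jM; split=> //.
    by move/(subsetP sM): jM; rewrite inE => /andP[].
  + move=> j jM; have [_ _ ->] := IN j (ltn_ord j); rewrite jM.
    by have := ltn_rank_card jM; lia.
  + move=> x y xM yM; have [_ _ ->] := IN x (ltn_ord x).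
    have [_ _ ->] := IN y (ltn_ord y); rewrite xM yM => _ [] E.
    exact: (rank_inj xM yM).
  + move=> j jQ; have [_ -> ->] := IN j (ltn_ord j).
    by case: ifP => // /NQ; rewrite jQ.
- move=> Q' j jd; have E1 : rec_end st' j = rec_end st j.
    rewrite /rec_end Een; case: eqP => // -[] /eqP.
    by rewrite eqn_pmul2r // (negPf jd).
  split=> // R; apply: row_eq R _ _ => // a x ain; apply: IO => // y.
  by case/cell_inj => E; rewrite E eqxx in jd.
Qed.

(** Separate from [store] because right after [lookup] the table lists a new set whose row is not
    filled yet. [table_reachable] bounds the number of records and [table_lt] the number of useful
    passes. *)
Record table qs st : Prop := Table {
  table_end : reg st rEnd = Posz (size qs * n);
  table_uniq : uniq qs;
  table_reachable : {subset qs <= reachable I};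
  table_lt : forall Q, Q \in qs -> #|Q| < k;
  table_dict : forall Q, arr st aDict (Posz (code Q)) =
    if Q \in qs then Posz (index Q qs * n).+1 else 0
}.

Definition store qs st : Prop :=
  table qs st /\ forall i, i < size qs -> row (nth set0 qs i) i st.

(** Facts about records persist along this relation: a set keeps its row and its end slot can only
    decrease. *)
Definition improves qs st qs' st' : Prop :=
  size qs <= size qs' /\ forall i, i < size qs ->
    nth set0 qs' i = nth set0 qs i /\ (rec_end st' i <= rec_end st i)%R.

Lemma improves_trans qs1 st1 qs2 st2 qs3 st3 : improves qs1 st1 qs2 st2 ->
  improves qs2 st2 qs3 st3 -> improves qs1 st1 qs3 st3.
Proof.
move=> [le12 H12] [le23 H23]; split; first exact: leq_trans le23.
move=> i lti; have [E1 l1] := H12 _ lti.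
have [E2 l2] := H23 _ (leq_trans lti le12).
by rewrite E2 E1; split=> //; apply: le_trans l1.
Qed.

Lemma improves_refl qs st : improves qs st qs st.
Proof. by []. Qed.

Definition recorded qs st Q t :=
  exists i, [/\ i < size qs, nth set0 qs i = Q & (rec_end st i <= t)%R].

Lemma recorded_improves qs st qs' st' Q t : improves qs st qs' st' ->
  recorded qs st Q t -> recorded qs' st' Q t.
Proof.
move=> [le H] [i [lti Ei lei]]; exists i; have [E l] := H _ lti.
by split; [apply: leq_trans le | rewrite E | apply: le_trans lei].
Qed.

Lemma table_unchanged c st st' qs : unchanged c st st' ->
  (rEnd \notin mod_regs c) && (aDict \notin mod_arrs c) -> table qs st -> table qs st'.
Proof.
by case=> U1 U2 /andP[h1 h2] [t1 t2 t3 t4 t5]; split=> //; [rewrite U1 | move=> Q; rewrite U2].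
Qed.

Lemma store_unchanged c st st' qs : unchanged c st st' ->
  (rEnd \notin mod_regs c) &&
  ~~ has [in [:: aDict; aEnd; aIn; aRecSlot; aRecMach]] (mod_arrs c) ->
  store qs st -> store qs st'.
Proof.
move=> U /andP[h1 /hasPn h2] [T R].
have h a : a \in [:: aDict; aEnd; aIn; aRecSlot; aRecMach] -> a \notin mod_arrs c.
  by move=> ain; apply: contraTN ain => /h2.
split; first by apply: table_unchanged U _ T; rewrite h1 h.
move=> i /R Ri; apply: row_eq Ri _ _ => [|a j ain].
  by rewrite /rec_end U.2 // h.
by rewrite U.2 // h //; move: ain; rewrite !inE => /or3P[] ->; rewrite ?orbT.
Qed.

Lemma upsert_spec st i s Q M qs : 0 < n -> env st -> store qs st ->
  i < size qs -> nth set0 qs i = Q -> reg st rRec = Posz (i * n) ->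
  reg st rSlot = s -> (rec_end st i < s)%R ->
  reg st rKey = Posz (code (Q :|: M)) ->
  (forall j : V, arr st aMask (Posz j) = Posz (j \in M)) ->
  M \subset avail Q s -> M != set0 -> #|M| <= m -> #|Q| + #|avail Q s| < k ->
  runs upsert st (100 * n + 200) (fun st' =>
    (exists qs', [/\ store qs' st', improves qs st qs' st'
                   & recorded qs' st' (Q :|: M) s]) /\
    unchanged upsert st st').
Proof.
move=> n0 e [T R] lti EQ Er Es lt Ek EM sM M0 leM ltk; apply: runs_unchanged.
have Ri := R _ lti; rewrite EQ in Ri; set Q' := Q :|: M in Ek *.
(* This keeps the row to be written different from the row being read. *)
have QM : Q' != Q.
  case/set0Pn: M0 => x xM; apply: contraTneq (subsetP sM _ xM) => E.
  by rewrite inE negb_and [x \in enabled Q]inE -E inE xM orbT.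
(* Common end of the two cases, an existing record that is improved and a fresh one: every row
   except [d] is valid before the write. *)
have conclude qs' d st1 : table qs' st1 -> d < size qs' -> nth set0 qs' d = Q' ->
    (forall j, j < size qs' -> j != d -> row (nth set0 qs' j) j st1) -> d != i ->
    env st1 -> reg st1 rRec = Posz (i * n) -> reg st1 rDest = Posz (d * n) ->
    reg st1 rSlot = s -> i < size qs' -> nth set0 qs' i = Q ->
    rec_end st1 i = rec_end st i -> (s < rec_end st1 d)%R ->
    (forall j : V, arr st1 aMask (Posz j) = Posz (j \in M)) ->
    improves qs st qs' st1 ->
    runs write_rec st1 (100 * n + 100) (fun st' => exists qs',
      [/\ store qs' st', improves qs st qs' st' & recorded qs' st' Q' s]).
  move=> T1 ltd Ed R1 di e1 Er1 Ed1 Es1 lti1 Ei1 Ee1 lt1 EM1 imp.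
  have Ri1 : row Q i st1 by rewrite -Ei1; apply: R1 => //; rewrite eq_sym.
  apply: runs_weak (write_rec_spec n0 e1 Er1 Ed1 _ Ri1 _ Es1 EM1 sM leM) _ _ => //.
    by rewrite eq_sym.
    by rewrite Ee1.
  move=> st' [Rd Ee Ro U]; exists qs'; split.
  - split; first exact: table_unchanged U _ T1.
    move=> j ltj; have [->|jd] := eqVneq j d; first by rewrite Ed.
    by have [_ H] := Ro (nth set0 qs' j) j jd; apply/H/R1.
  - apply: improves_trans imp _; split=> // j ltj; split=> //.
    have [->|jd] := eqVneq j d; first by rewrite Ee ltW.
    by have [-> _] := Ro set0 j jd.
  - by exists d; split=> //; rewrite Ee.
rewrite /upsert; apply: runs_weak (runs_seq_straight _ _) _ (fun st' H => H); first by [].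
- apply: (runs_if (n := 100 * n + 100)); have D := table_dict T Q'.
  case: (boolP (Q' \in qs)) => Q'in; rewrite ?Q'in ?(negPf Q'in) in D.
    set d := index Q' qs in D; have ltd : d < size qs by rewrite index_mem.
    have Ed : nth set0 qs d = Q' by rewrite nth_index.
    have -> : sem lookup st = set_reg st rDest (Posz (d * n)).
      by rewrite /= Ek D /= Ek D; congr set_reg; lia.
    rewrite [holds _ _]/= Es -/(rec_end st d); case: ifPn => lt1.
      apply: (conclude qs d) => //; first by case: T; split.
      + by move=> j /R H _; apply: row_eq H _ _.
      + by apply: contraNneq QM => E; rewrite -Ed E EQ.
      + by case: e; split.
      + by rewrite /rec_end /= -/(rec_end st d); lia.
    apply: runs_weak (runs_straight _ _) _ (fun st' H => H); [by [] | | by rewrite /=; lia].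
    exists qs; split=> //.
      by split=> [|j /R H]; [case: T; split | apply: row_eq H _ _].
    by exists d; split=> //; rewrite /rec_end /= -/(rec_end st d); lia.
  set d := size qs.
  have -> : sem lookup st = set_reg (set_reg (set_arr (set_arr st aDict
      (Posz (code Q')) (Posz (d * n).+1)) aEnd (Posz (d * n)) (s + 1)%R)
      rEnd (Posz (d.+1 * n))) rDest (Posz (d * n)).
    rewrite /= Ek D /= Ek eqxx (table_end T) Es (env_jobs e) -/d.
    by congr (set_reg (set_reg (set_arr (set_arr _ _ _ _) _ _ _) _ _) _ _); lia.
  rewrite [holds _ _]/= Es eqxx lexx.
  have nat_rec j : j < d -> (Posz (j * n) == Posz (d * n)) = false.
    by move=> ltj; rewrite eqz_nat eqn_pmul2r // ltn_eqF.
  have nthj j : j < d -> nth set0 (rcons qs Q') j = nth set0 qs j.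
    by move=> ltj; rewrite nth_rcons ltj.
  apply: (conclude (rcons qs Q') d).
  + split; rewrite ?size_rcons ?rcons_uniq ?Q'in ?(table_uniq T) //.
    * move=> X; rewrite mem_rcons inE => /predU1P[->|/(table_reachable T) //].
      by apply: reachable_step ltk sM; [apply: ps_downset (row_ps Ri) |];
         move=> j /(ps_slot (row_ps Ri)) [h1 h2]; lia.
    * move=> X; rewrite mem_rcons inE => /predU1P[->|/(table_lt T) //].
      by have := subset_leq_card sM; have := leq_card_setU Q M => -[]; rewrite /Q'; lia.
    * move=> X /=; rewrite eqz_nat (inj_eq code_inj) mem_rcons inE -cats1.
      rewrite index_cat (table_dict T) /=; have [->|XQ] := eqVneq X Q'.
        by rewrite (negPf Q'in) ?eqxx addn0.
      by case: ifP.
  + by rewrite size_rcons.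
  + by rewrite nth_rcons ltnn eqxx.
  + move=> j; rewrite size_rcons ltnS leq_eqVlt => /predU1P[->|ltj _]; first by rewrite eqxx.
    rewrite nthj //; apply: row_eq (R _ ltj) _ _ => [|a x].
      by rewrite /rec_end /= nat_rec.
    by rewrite !inE => /or3P[] /eqP->.
  + by rewrite gtn_eqF.
  + by case: e; split.
  + by [].
  + by [].
  + by [].
  + by rewrite size_rcons ltnS ltnW.
  + by rewrite nthj.
  + by rewrite /rec_end /= nat_rec.
  + by rewrite /rec_end /= eqxx; lia.
  + by [].
  + split=> [|j ltj]; first by rewrite size_rcons.
    by rewrite nthj // /rec_end /= nat_rec.
by rewrite /=; lia.
Qed.

(** * Enumeration of subsets by a binary counter *)

Lemma next_mask_spec st A M : reg st rJobs = Posz n ->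
  (forall j : V, arr st aFree (Posz j) = Posz (j \in A)) ->
  (forall j : V, arr st aMask (Posz j) = Posz (j \in M)) ->
  runs next_mask st (100 * n + 100) (fun st' =>
    (reg st' rIdx = Posz n /\ A \subset M \/
     exists x : V, [/\ reg st' rIdx = Posz x, x \in A, x \notin M,
       forall y : V, y < x -> y \in A -> y \in M
       & forall j : V, arr st' aMask (Posz j) = Posz ((j \in M) && (x <= j))]) /\
    unchanged next_mask st st').
Proof.
move=> En EA EM; apply: runs_unchanged.
pose Inv f st' := exists i, [/\ i + f = n, reg st' rIdx = Posz i,
  forall j : V, arr st' aMask (Posz j) = Posz ((j \in M) && (i <= j)),
  forall y : V, y < i -> y \in A -> y \in M
  & reg st' rJobs = Posz n /\ forall j : V, arr st' aFree (Posz j) = Posz (j \in A)].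
have I0 : Inv n (set_reg st rIdx 0).
  by exists 0; split=> // j; rewrite /= EM andbT.
apply: runs_weak (runs_seq_straight (c1 := rIdx ::= EConst 0) (st := st) _
  (runs_while (n := 8) (Inv := Inv) _ _ I0)) _ (fun st' H => H) => //.
- move=> f st' [i [fi Ei IM low [En' EA']]]; rewrite /= Ei En'.
  have [lti|gei] := ltnP i n; last first.
    move=> _; left; have Ein : i = n by lia.
    split; first by rewrite Ein.
    by apply/subsetP=> y; apply: low; rewrite Ein.
  have := EA' (Ordinal lti); have := IM (Ordinal lti) => /= -> ->.
  rewrite leqnn andbT => H; right; exists (Ordinal lti).
  have xA : Ordinal lti \in A.
    by move: H; case: (Ordinal lti \in A) => //=; lia.
  have xM : Ordinal lti \notin M.
    by move: H; rewrite xA; case: (Ordinal lti \in M) => //=; lia.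
  by split.
- move=> f st' [i [fi Ei IM low [En' EA']]]; rewrite /= Ei En' => /andP[h1 h2].
  have lti : i < n by lia.
  split; first by lia.
  apply: runs_weak (runs_straight _ _) _ (fun st2 H => H) => //.
  move: h2; have := EA' (Ordinal lti); have := IM (Ordinal lti) => /= -> ->.
  rewrite leqnn andbT => H; exists i.+1; split=> //=.
  + by lia.
  + by rewrite Ei; lia.
  + move=> j; rewrite Ei eqz_nat IM; case: eqVneq => [->|ne]; first by rewrite ltnn andbF.
    by rewrite [i < j]ltn_neqAle eq_sym ne.
  + move=> y; rewrite ltnS leq_eqVlt => /predU1P[Ey|]; last exact: low.
    have -> : y = Ordinal lti by apply: val_inj.
    by move: H; case: (_ \in A); case: (_ \in M).
- by rewrite /=; lia.
Qed.

Lemma try_mask_spec st i s Q M qs : 0 < n -> env st -> store qs st ->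
  i < size qs -> nth set0 qs i = Q -> reg st rRec = Posz (i * n) ->
  reg st rSlot = s -> (rec_end st i < s)%R -> reg st rCode = Posz (code Q) ->
  (forall j : V, arr st aMask (Posz j) = Posz (j \in M)) ->
  M \subset avail Q s -> M != set0 -> #|Q| + #|avail Q s| < k ->
  runs try_mask st (200 * n + 400) (fun st' =>
    (exists qs', [/\ store qs' st', improves qs st qs' st'
                   & #|M| <= m -> recorded qs' st' (Q :|: M) s]) /\
    unchanged try_mask st st').
Proof.
move=> n0 e S lti EQ Er Es lt Ec EM sM M0 ltk; apply: runs_unchanged.
have dis : [disjoint Q & M].
  rewrite disjoint_sym disjoints_subset; apply/subsetP=> x /(subsetP sM).
  by rewrite !inE => /andP[/andP[]].
apply: runs_weak (runs_seq (n2 := 100 * n + 250) (measure_mask_spec e Ec EM dis) _)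
  _ (fun st' H => H); last by lia.
move=> st1 [E1 E2 U1].
have e1 := env_unchanged U1 isT e; have S1 := store_unchanged U1 isT S.
apply: runs_weak (runs_if (n := 100 * n + 240) _) _ (fun st2 H => H); last by rewrite /=; lia.
rewrite [holds _ _]/= E1 (env_machines e1) -[(_ <= _)%R]/(#|M| <= m).
have Ee j : rec_end st1 j = rec_end st j by rewrite /rec_end (U1.2 aEnd).
have imp qs' st' : improves qs st1 qs' st' -> improves qs st qs' st'.
  by case=> h1 h2; split=> // j /h2; rewrite Ee.
case: ifP => leM.
  apply: runs_weak (upsert_spec (i := i) (s := s) (Q := Q) (M := M)
    n0 e1 S1 lti EQ _ _ _ _ _ sM M0 leM ltk) _ _.
  - by rewrite (U1.1 rRec).
  - by rewrite (U1.1 rSlot).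
  - by rewrite Ee.
  - by [].
  - by move=> j; rewrite (U1.2 aMask).
  - by lia.
  by move=> st' [[qs' [h1 h2 h3]] _]; exists qs'; split=> //; apply: imp.
apply: runs_weak (runs_straight _ _) _ (fun st2 H => H); [by [] | | by rewrite /=; lia].
by exists qs; split=> //; apply: imp; apply: improves_refl.
Qed.

Lemma enumerate_spec st i s Q qs : 0 < n -> env st -> store qs st ->
  i < size qs -> nth set0 qs i = Q -> reg st rRec = Posz (i * n) ->
  reg st rSlot = s -> (rec_end st i < s)%R -> reg st rCode = Posz (code Q) ->
  (forall j : V, arr st aFree (Posz j) = Posz (j \in avail Q s)) ->
  #|Q| + #|avail Q s| < k ->
  runs enumerate st (1000 * n * 2 ^ k) (fun st' =>
    (exists qs', [/\ store qs' st', improves qs st qs' st'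
       & forall M, M \subset avail Q s -> M != set0 -> #|M| <= m ->
           recorded qs' st' (Q :|: M) s]) /\
    unchanged enumerate st st').
Proof.
move=> n0 e S lti EQ Er Es lt Ec EF ltk; apply: runs_unchanged.
set A := avail Q s in EF ltk *.
pose clr i st' := forall j : V, j < i -> arr st' aMask (Posz j) = 0.
apply: runs_weak (runs_seq (n2 := 2 ^ #|A| * (300 * n + 600) + 10)
  (runs_for (Inv := clr) (n := n) (kb := 10) _ _ _ _) _) _ (fun st' H => H).
- by [].
- exact: env_jobs.
- by [].
- move=> x st' Ex U Ic.
  apply: runs_weak (runs_straight _ _) _ (fun st2 H => H) => // j jx /=.
  by rewrite Ex cellE; case: eqVneq => // ne; apply/Ic/ltn_succ_neq.
- move=> st1 [clr1 U1].
  apply: runs_weak (runs_seq_straight (n := 2 ^ #|A| * (300 * n + 600) + 8) _ _)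
    _ (fun st' H => H); first by [].
    set st0 := sem _ _.
    have e0 : env st0 by case: (env_unchanged U1 isT e); split.
    have S0 : store qs st0.
      have [T R] := store_unchanged U1 isT S; split; first by case: T; split.
      by move=> j /R H; apply: row_eq H _ _.
    have Ee j : rec_end st0 j = rec_end st j by rewrite /rec_end /= (U1.2 aEnd).
    (* Nonempty subsets of weight up to [w] have been dealt with. In the invariant below, the fuel
       is the distance from the current weight to [2 ^ #|A|]. *)
    pose covered qs' st' w := forall M, M \subset A -> M != set0 -> #|M| <= m ->
      weight A M n <= w -> recorded qs' st' (Q :|: M) s.
    pose Inv f st' := exists qs', [/\ store qs' st', improves qs st0 qs' st',
      unchanged next_subset st0 st'
      & reg st' rGo = 0 /\ covered qs' st' (2 ^ #|A|) \/
        reg st' rGo = 1 /\ exists M, [/\ M \subset A,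
          forall j : V, arr st' aMask (Posz j) = Posz (j \in M),
          covered qs' st' (weight A M n) & weight A M n + f = 2 ^ #|A|]].
    have I0 : Inv (2 ^ #|A|) st0.
      exists qs; split; [by [] | by [] | by split | right; split=> //].
      have w0 : weight A set0 n = 0.
        by rewrite /weight prefix_sum_total big1 // => x _; rewrite inE.
      exists set0; split; rewrite ?sub0set ?w0 //.
        by move=> j; rewrite inE /= clr1.
      move=> M sM M0 leM; rewrite leqn0 => /eqP wM; case/negP: M0; apply/eqP.
      by apply: (weight_inj sM (sub0set _)); rewrite wM w0.
    apply: runs_weak (runs_while (n := 300 * n + 550) (Inv := Inv) _ _ I0) _ (fun st' H => H).
    + move=> f st' [qs' [S' imp _ H]] /=; case: H => [[_ cov] _|[-> //]].
      exists qs'; split=> //; first by case: imp => h1 h2; split=> // j /h2; rewrite Ee.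
      move=> M sM M0 leM; apply: cov => //; apply: ltnW.
      by rewrite -(rank_total A); apply: weight_lt.
    + move=> f st' [qs' [S' imp U H]] /= go1.
      case: H => [[go0]|[_ [M [sM EM cov fw]]]]; first by rewrite go0 in go1.
      have wlt : weight A M n < 2 ^ #|A| by rewrite -(rank_total A); apply: weight_lt.
      split; first by lia.
      have e' := env_unchanged U isT e0.
      have EF' (j : V) : arr st' aFree (Posz j) = Posz (j \in A).
        by rewrite (U.2 aFree) //= (U1.2 aFree).
      apply: runs_weak (runs_seq (n2 := 200 * n + 440)
        (next_mask_spec (env_jobs e') EF' EM) _) _ (fun st2 H => H); last by lia.
      move=> st2 [out U2].
      apply: runs_weak (runs_if (n := 200 * n + 430) _) _ (fun st3 H => H); last first.
        by rewrite /=; lia.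
      have e2 := env_unchanged U2 isT e'; have S2 := store_unchanged U2 isT S'.
      have Ee2 j : rec_end st2 j = rec_end st' j by rewrite /rec_end (U2.2 aEnd).
      have V2 := unchanged_trans U (unchanged_sub (c := next_subset) U2 isT).
      have rec2 X : recorded qs' st' X s -> recorded qs' st2 X s.
        by case=> j [h1 h2 h3]; exists j; rewrite Ee2.
      rewrite [holds _ _]/= (env_jobs e2).
      case: out => [[-> sAM]|[x [Ex xA xM low EM2]]].
        rewrite lexx; apply: runs_weak (runs_straight _ _) _ (fun st3 H => H);
          [by [] | | by rewrite /=; lia].
        exists qs'; split.
        * by case: S2 => [[t1 t2 t3 t4 t5] R]; split=> // j /R H; apply: row_eq H _ _.
        * case: imp => h1 h2; split=> // j /h2.
          by rewrite {2}/rec_end /= -/(rec_end st2 j) Ee2.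
        * have W := sem_unchanged st2 (isT : straight (rGo ::= EConst 0)).
          exact: unchanged_trans V2 (unchanged_sub (c := next_subset) W isT).
        (* At overflow the mask contains all of [A], so every subset has at most its weight. *)
        * left; split=> // X sX X0 leX _.
          have := rec2 _ (cov X sX X0 leX (leq_weight _ _ (subset_trans sX sAM))).
          by case=> j [h1 h2 h3]; exists j.
      rewrite Ex (_ : (Posz n <= Posz x)%R = false); last by have := ltn_ord x; lia.
      set st3 := sem (CStore aMask (EReg rIdx) (EConst 1)) st2.
      have W := sem_unchanged st2 (isT : straight (CStore aMask (EReg rIdx) (EConst 1))).
      have V3 : unchanged next_subset st0 st3.
        exact: unchanged_trans V2 (unchanged_sub (c := next_subset) W isT).
      have Ee3 j : rec_end st3 j = rec_end st' j by rewrite -Ee2.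
      have EM3 (j : V) : arr st3 aMask (Posz j) = Posz (j \in incr_mask M x).
        rewrite /= Ex cellE EM2 !inE; case: eqVneq => //= ne.
        by rewrite [x < j]ltn_neqAle eq_sym val_eqE ne.
      have sM' : incr_mask M x \subset A.
        apply/subsetP=> j; rewrite in_setU1 => /predU1P[->//|].
        by rewrite [j \in [set y in M | _]]inE => /andP[jM _]; apply: (subsetP sM).
      have M'0 : incr_mask M x != set0 by apply/set0Pn; exists x; rewrite !inE eqxx.
      have wM' := weight_incr sM xA xM low.
      have [imp1 imp2] := imp; have [EQ' lei] := imp2 _ lti; rewrite Ee in lei.
      apply: runs_weak (runs_seq_straight _ (try_mask_spec (i := i) (s := s) (Q := Q)
        (M := incr_mask M x) (qs := qs') n0 _ _ _ _ _ _ _ _ EM3 sM' M'0 ltk)) _ _.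
      * by [].
      * by apply: env_unchanged W isT e2.
      * by apply: store_unchanged W isT S2.
      * exact: leq_trans imp1.
      * by rewrite EQ'.
      * by rewrite (V3.1 rRec) //= (U1.1 rRec).
      * by rewrite (V3.1 rSlot) //= (U1.1 rSlot).
      * by rewrite Ee3; apply: le_lt_trans lt.
      * by rewrite (V3.1 rCode) //= (U1.1 rCode).
      * by rewrite /=; lia.
      move=> st4 [[qs4 [S4 imp4 rec4]] U4]; exists qs4.
      have imp34 : improves qs' st' qs4 st4.
        by case: imp4 => h1 h2; split=> // j /h2; rewrite Ee3.
      split=> //.
      * exact: improves_trans imp imp34.
      * exact: unchanged_trans V3 (unchanged_sub (c := next_subset) U4 isT).
      right; split; first by rewrite (U4.1 rGo) //= (U2.1 rGo) //; apply/eqP.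
      exists (incr_mask M x); split=> //.
      * by move=> j; rewrite (U4.2 aMask).
      (* The weight rose by one, and by [weight_inj] the new mask is the only subset of exactly that
         weight. *)
      * move=> X sX X0 leX; rewrite wM' leq_eqVlt => /predU1P[EX|].
          have -> : X = incr_mask M x by apply: (weight_inj sX sM'); rewrite EX.
          apply: rec4; rewrite (_ : incr_mask M x = X) //.
          by apply: (weight_inj sM' sX); rewrite EX.
        by rewrite ltnS => /(cov X sX X0 leX); apply: recorded_improves.
      * by rewrite wM'; lia.
    + by rewrite /=; lia.
  by rewrite /=; lia.
have : 2 ^ #|A| <= 2 ^ k.-1 by rewrite leq_exp2l //; lia.
have : 2 ^ k = 2 * 2 ^ k.-1 by rewrite -expnS prednK //; lia.
have := expn_gt0 2 k.-1; move: (2 ^ #|A|) (2 ^ k) (2 ^ k.-1) => a b c /= c0 -> ac.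
have h1 : a * n <= c * n by rewrite leq_mul2r ac orbT.
have h2 : c <= c * n by rewrite leq_pmulr.
have h3 : n <= c * n by rewrite leq_pmull.
by move: h1 h2 h3 ac n0 c0; clear; move: n => n'; nia.
Qed.

(** * Expansion of one record and passes over the table *)

Section Search.
Hypotheses (k0 : 0 < k) (lekn : k <= n) (m0 : 0 < m).

Lemma output_unchanged c st st' : unchanged c st st' ->
  ~~ has [in [:: rFound; rBest]] (mod_regs c) &&
  ~~ has [in [:: aSel; aMach; aSlot]] (mod_arrs c) -> output st ->
  output st' /\ forall C, found_by C st -> found_by C st'.
Proof.
case=> U1 U2 /andP[/hasPn H1 /hasPn H2] out.
have R x : x \in [:: rFound; rBest] -> reg st' x = reg st x.
  by move=> xin; apply: U1; apply: contraTN xin => /H1.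
have A a i : a \in [:: aSel; aMach; aSlot] -> arr st' a i = arr st a i.
  by move=> ain; apply: U2; apply: contraTN ain => /H2.
split; last by move=> C [h1 h2]; split; rewrite R.
case: out => [h|[h [Q [h1 h2 h3]]]]; [left | right]; rewrite R //; split=> //.
exists Q; split=> // [j|]; first by rewrite A.
by rewrite R //; apply: eq_partial_schedule h3 _ _ => j; rewrite A.
Qed.

(** The potential of the Bellman-Ford argument: deadline [C] is attainable from a record with at
    least [a] jobs, and with [i] the current position this record has not been visited yet in the
    pass. *)
Definition hopeful qs st i a C :=
  exists d, [/\ i <= d < size qs, a <= #|nth set0 qs d|
              & completable (nth set0 qs d) (rec_end st d) C].

Lemma hopeful_improves qs st qs' st' i a C : improves qs st qs' st' ->
  hopeful qs st i a C -> hopeful qs' st' i a C.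
Proof.
move=> [le H] [d [/andP[id ltd] ad cd]]; have [Ed led] := H _ ltd.
exists d; rewrite id (leq_trans ltd le) Ed; split=> //.
exact: completable_le led cd.
Qed.

(** One relaxation: a deadline attainable from the record is met by [finish], or, by
    [completable_step], stays attainable from a strictly larger recorded set. *)
Lemma expand_spec st i qs : env st -> store qs st -> output st ->
  i < size qs -> reg st rRec = Posz (i * n) ->
  runs expand st (2000 * (n + E) * 2 ^ k) (fun st' =>
    (exists qs', [/\ store qs' st', output st', improves qs st qs' st',
      forall C, found_by C st -> found_by C st'
      & forall C, completable (nth set0 qs i) (rec_end st i) C ->
          found_by C st' \/ hopeful qs' st' 0 #|nth set0 qs i|.+1 C]) /\
    unchanged expand st st').
Proof.
move=> e S out lti Er; apply: runs_unchanged.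
have n0 : 0 < n by lia.
have [T R] := S; have [EI PS] := R _ lti.
have ltQ : #|nth set0 qs i| < k by apply: (table_lt T); apply: mem_nth.
set Q := nth set0 qs i in EI PS ltQ *; set t := rec_end st i in PS *.
apply: runs_weak (runs_seq (n2 := 200 * n + 100 * E + 400 + 1100 * n * 2 ^ k)
  (scan_spec e Er EI) _) _ (fun st' H => H); last first.
  by have := expn_gt0 2 k; move: (2 ^ k) n0 => b; clear; move: n E => n' E'; nia.
move=> st1 [F1 Z1 C1 U1].
have e1 := env_unchanged U1 isT e.
have EI1 (j : V) : arr st1 aIn (Posz (i * n + j)) = Posz (j \in Q).
  by rewrite (U1.2 aIn) // EI.
have Er1 : reg st1 rRec = Posz (i * n) by rewrite (U1.1 rRec).
apply: runs_weak (runs_seq (n2 := 200 * n + 300 + 1100 * n * 2 ^ k)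
  (block_spec e1 Er1 EI1 F1) _) _ (fun st' H => H); last by lia.
move=> st2 [F2 U2]; have e2 := env_unchanged U2 isT e1.
have Er2 : reg st2 rRec = Posz (i * n) by rewrite (U2.1 rRec).
have Et2 : arr st2 aEnd (Posz (i * n)) = t by rewrite (U2.2 aEnd) // (U1.2 aEnd).
apply: runs_weak (runs_seq (n2 := 100 * n + 200 + 1100 * n * 2 ^ k)
  (find_slot_spec e2 Er2 Et2 F2 (leq_trans ltQ lekn)) _) _ (fun st' H => H); last by lia.
move=> st3 [ns U3]; have e3 := env_unchanged U3 isT e2.
set s := reg st3 rSlot in ns.
have F3 (j : V) : arr st3 aFree (Posz j) = Posz (j \in enabled Q).
  by rewrite (U3.2 aFree).
apply: runs_weak (runs_seq (n2 := 100 + 1100 * n * 2 ^ k)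
  (filter_avail_spec e3 (erefl s) F3) _) _ (fun st' H => H); last by lia.
move=> st4 [F4 A4 U4]; have e4 := env_unchanged U4 isT e3.
have Z4 : reg st4 rSize = Posz #|Q|.
  by rewrite (U4.1 rSize) // (U3.1 rSize) // (U2.1 rSize).
have C4 : reg st4 rCode = Posz (code Q).
  by rewrite (U4.1 rCode) // (U3.1 rCode) // (U2.1 rCode).
have Er4 : reg st4 rRec = Posz (i * n) by rewrite (U4.1 rRec) // (U3.1 rRec).
have Es4 : reg st4 rSlot = s by rewrite (U4.1 rSlot).
have S4 : store qs st4.
  by do 4![apply: store_unchanged; [eassumption | by [] |]].
have [out4 fnd4] : output st4 /\ forall C, found_by C st -> found_by C st4.
  have [o1 f1] := output_unchanged U1 isT out.
  have [o2 f2] := output_unchanged U2 isT o1.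
  have [o3 f3] := output_unchanged U3 isT o2.
  have [o4 f4] := output_unchanged U4 isT o3.
  by split=> // C /f1/f2/f3/f4.
have Ee4 j : rec_end st4 j = rec_end st j.
  by rewrite /rec_end (U4.2 aEnd) // (U3.2 aEnd) // (U2.2 aEnd) // (U1.2 aEnd).
have imp4 qs' st' : improves qs st4 qs' st' -> improves qs st qs' st'.
  by case=> h1 h2; split=> // j /h2; rewrite Ee4.
have [lt_ts _ _] := ns.
apply: runs_weak (runs_if (n := 10 + 1000 * n * 2 ^ k) _) _ (fun st' H => H); last first.
  by have := expn_gt0 2 k; move: (2 ^ k) n0 => b; clear; move: n => n' /=; nia.
rewrite [holds _ _]/= (env_target e4) Z4 A4 -PoszD lez_nat.
have [EI4 PS4] := S4.2 _ lti; rewrite Ee4 -/t -/Q in PS4; rewrite -/Q in EI4.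
case: leqP => cmp.
  apply: runs_weak (finish_spec e4 m0 ltQ Er4 EI4 PS4 Z4 Es4 lt_ts F4 cmp lekn out4) _ _.
    by have := expn_gt0 2 k; move: (2 ^ k) n0 => b; clear; move: n => n' /=; nia.
  move=> st5 [out5 fb5 fnd5 U5]; exists qs; split=> //.
  - exact: store_unchanged U5 isT S4.
  - apply: imp4; split=> // j ltj; split=> //.
    by rewrite /rec_end (U5.2 aEnd).
  - by move=> C /fnd4/fnd5.
  - move=> C cC; left; case: fb5 => h1 h2; split=> //; apply: le_trans h2 _.
    exact: completable_slots m0 ltQ ns cC.
apply: runs_weak (enumerate_spec (i := i) n0 e4 S4 lti (erefl Q) Er4 Es4 _ C4 F4 cmp) _ _.
- by rewrite Ee4.
- by lia.
move=> st5 [[qs5 [S5 imp5 rec5]] U5].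
have [out5 fnd5] := output_unchanged U5 isT out4.
exists qs5; split=> //; first exact: imp4.
  by move=> C /fnd4/fnd5.
move=> C cC; right; have [M [sM M0 leM cM]] := completable_step m0 ns cC.
have [d [ltd Ed led]] := rec5 M sM M0 leM; exists d; rewrite ltd Ed; split=> //.
  apply: proper_card; rewrite properE subsetUl; case/set0Pn: M0 => x xM.
  apply/subsetPn; exists x; first by rewrite inE xM orbT.
  by have := subsetP sM _ xM; rewrite inE => /andP[/enabledP[]].
exact: completable_le led cM.
Qed.

Lemma size_store qs st : store qs st -> size qs <= 2 ^ k * 2 ^ k.
Proof.
case=> T _; apply: leq_trans (card_reachable I); rewrite cardE.
by apply: uniq_leq_size (table_uniq T) _ => Q /(table_reachable T); rewrite mem_enum.
Qed.

(** State after [a] passes; [goals] will be the deadlines attainable from the empty set. *)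
Definition progress (goals : int -> Prop) a st : Prop :=
  exists qs, [/\ env st, store qs st, output st
    & forall C, goals C -> found_by C st \/ hopeful qs st 0 a C].

Lemma pass_spec goals a st : progress goals a st ->
  runs pass st (2100 * (n + E) * 8 ^ k) (progress goals a.+1).
Proof.
move=> [qs0 [e0 S0 out0 H0]]; have n0 : 0 < n by lia.
(* A goal is met, has already moved to a set of size at least [a.+1], or waits at a record still
   ahead. At the end of the pass no record is ahead and the third case disappears. *)
pose Inv f st' := exists qs i, [/\ i + f = 2 ^ k * 2 ^ k, reg st' rRec = Posz (i * n),
  env st', store qs st' /\ output st'
  & forall C, goals C ->
      [\/ found_by C st', hopeful qs st' 0 a.+1 C | hopeful qs st' i a C]].
have I0 : Inv (2 ^ k * 2 ^ k) (set_reg st rRec 0).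
  exists qs0, 0; split=> //; first by case: e0; split.
    split=> //; case: S0 => [[t1 t2 t3 t4 t5] R]; split=> // j /R h.
    by apply: row_eq h _ _.
  move=> C /H0[h|h]; first by constructor 1.
  by constructor 3.
apply: runs_weak (runs_seq_straight (c1 := rRec ::= EConst 0) (st := st) _
  (runs_while (n := 2000 * (n + E) * 2 ^ k + 4) (Inv := Inv) _ _ I0)) _ (fun st' H => H).
- by [].
- move=> f st' [qs [i [fi Er e [S out] H]]] /=; rewrite Er (table_end S.1) => ge.
  have lei : size qs <= i.
    rewrite leqNgt; apply/negP=> lti; case/negP: ge.
    have : i.+1 * n <= size qs * n by rewrite leq_mul2r lti orbT.
    by rewrite mulSn; lia.
  exists qs; split=> // C /H[|h|[d [/andP[id ltd] _ _]]]; [by left | by right |].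
  by have := leq_trans ltd lei; rewrite ltnNge id.
- move=> f st' [qs [i [fi Er e [S out] H]]] /=; rewrite Er (table_end S.1) => lt.
  have lti : i < size qs.
    rewrite ltnNge; apply/negP=> gei.
    have : size qs * n <= i * n by rewrite leq_mul2r gei orbT.
    by lia.
  (* The table may grow during the pass, so the fuel is measured against the bound on its size and
     not against its current size. *)
  have := size_store S => les; split; first by lia.
  apply: runs_seq (expand_spec e S out lti Er) _ => st2.
  move=> [[qs2 [S2 out2 imp2 fnd2 new2]] U2].
  apply: runs_weak (runs_straight _ _) _ (fun st3 H => H) => //.
  have e2 := env_unchanged U2 isT e.
  exists qs2, i.+1; split.
  + by lia.
  + by rewrite /= (U2.1 rRec) // Er (env_jobs e2) mulSn; lia.
  + by case: e2; split.
  + split=> //; case: S2 => [[t1 t2 t3 t4 t5] R]; split=> // j /R h.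
    by apply: row_eq h _ _.
  move=> C gC; have [h|h|h] := H _ gC.
  + by constructor 1; apply: fnd2.
  + by constructor 2; apply: hopeful_improves imp2 h.
  case: h => d [/andP[]]; rewrite leq_eqVlt => /predU1P[<- _ ad cd|id ltd ad cd].
    have [h|[d' [ltd' ad' cd']]] := new2 _ cd; first by constructor 1.
    by constructor 2; exists d'; split=> //; apply: leq_trans ad'.
  by constructor 3; apply: (hopeful_improves imp2); exists d; rewrite id ltd.
have -> : 8 ^ k = 2 ^ k * 2 ^ k * 2 ^ k by rewrite -!expnMn.
have := expn_gt0 2 k; move: (2 ^ k) n0 => b; clear; move: n E => n' E' /= n0 b0.
have h1 : 1 <= b * b * b * (n' + E').
  by rewrite !muln_gt0 b0 /=; lia.
have h2 : b * b <= b * b * b * (n' + E').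
  by rewrite -mulnA leq_pmulr // muln_gt0 b0; lia.
have -> : 2100 * (n' + E') * (b * b * b) = 2100 * (b * b * b * (n' + E')) by lia.
have -> : 2000 * (n' + E') * b = 2000 * (b * (n' + E')) by lia.
have : b * b * (b * (n' + E')) = b * b * b * (n' + E') by rewrite !mulnA.
move: (b * b * b * (n' + E')) (b * (n' + E')) (b * b) h1 h2 => x y z h1 h2 E.
by rewrite -E; nia.
Qed.

Lemma init_spec :
  runs (init_powers;; init_bounds;; init_store) (input_state I) (200 * n + 200)
    (fun st => exists2 t, (forall j, (t < r j)%R)
       & progress (completable (@set0 V) t) 0 st).
Proof.
have n0 : 0 < n by lia.
pose pows i st := (forall j : V, j < i -> arr st aPow (Posz j) = Posz (2 ^ rank [set: V] j))
  /\ reg st rKey = Posz (2 ^ rank [set: V] i).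
apply: runs_weak (runs_seq (n2 := 150 * n + 150)
  (runs_unchanged (runs_seq_straight _
    (runs_for (Inv := pows) (n := n) (kb := 7) _ _ _ _))) _) _ (fun st' H => H).
- by [].
- by [].
- by [].
- by split=> //=; rewrite /rank prefix_sum0.
- move=> x st' Ex U [IP IK].
  apply: runs_weak (runs_straight _ _) _ (fun st2 H => H) => //; split=> /=.
    move=> j jx; rewrite Ex cellE; case: eqVneq => [->|ne]; first exact: IK.
    exact/IP/ltn_succ_neq.
  by rewrite IK /rank prefix_sumS inE /= expnD expn1 muln2 -addnn.
- move=> st1 [[[IP _] _] U1].
  have ER1 (j : V) : arr st1 aRel (Posz j) = r j.
    by rewrite (U1.2 aRel) //= valK.
  have En1 : reg st1 rJobs = Posz n by rewrite (U1.1 rJobs).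
  pose bnds i st := forall j : V, j < i -> (reg st rSlot <= r j <= reg st rMaxRel)%R.
  apply: runs_weak (runs_seq (n2 := 20) (runs_unchanged (runs_seq_straight _
    (runs_for (Inv := bnds) (n := n) (kb := 20) _ _ _ _))) _) _ (fun st' H => H).
  + by [].
  + by [].
  + by [].
  + by [].
  + move=> x st' Ex U IB.
    apply: runs_weak (runs_straight _ _) _ (fun st2 H => H) => //.
    have ER : arr st' aRel (Posz x) = r x by rewrite (U.2 aRel) //= ER1.
    have step st2 : (reg st2 rSlot <= reg st' rSlot)%R ->
        (reg st' rMaxRel <= reg st2 rMaxRel)%R ->
        (reg st2 rSlot <= r x <= reg st2 rMaxRel)%R -> bnds x.+1 st2.
      move=> h1 h2 h3 j jx; have [-> //|ne] := eqVneq j x.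
      have /andP[h4 h5] := IB _ (ltn_succ_neq jx ne).
      by rewrite (le_trans h1 h4) (le_trans h5 h2).
    rewrite [sem _ _]/= Ex ER.
    case: (leP (r x) (reg st' rSlot)) => c1 /=; rewrite Ex ER;
      case: leP => c2; apply: step => //=; rewrite ?lexx //; try exact: ltW;
      by rewrite ?c1 ?c2 ?(ltW c1) ?(ltW c2).
  + move=> st2 [[IB _] U2].
    apply: runs_weak (runs_straight _ _) _ (fun st3 H => H) => //.
    have AI a i : a \notin [:: aPow; aEnd; aDict] -> arr st2 a i = input_arr I a i.
      by move=> h; rewrite (U2.2 a) // (U1.2 a) //; move: h; rewrite !inE !negb_or => /and3P[].
    have RI x : x \notin [:: rKey; rIdx; rSlot; rMaxRel] -> reg st2 x = input_reg I x.
      move=> h; rewrite (U2.1 x) // ?(U1.1 x) //; move: h; rewrite !inE ?negb_or.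
        by case/and4P=> -> -> _ _.
      by case/and4P=> _ -> -> ->.
    (* One slot before the earliest release date, so that every [k]-schedule is a completion of the
       empty set. *)
    exists (reg st2 rSlot - 1)%R.
      by move=> j; have /andP[h _] := IB j (ltn_ord j); lia.
    exists [:: set0]; split.
    * split=> [||||j|j|e|e|j] /=; [exact: RI | exact: RI | exact: RI | exact: RI
        | | rewrite AI // | rewrite AI // | rewrite AI // |].
      - by case/andP: (IB j (ltn_ord j)).
      - by rewrite /= valK.
      - by rewrite /= (nth_map (arcn e)) // [in RHS](tnth_nth (arcn e)).
      - by rewrite /= (nth_map (arcn e)) // [in RHS](tnth_nth (arcn e)).
      - by rewrite (U2.2 aPow) // IP.
    * have c0 : code (set0 : {set V}) = 0.
        by rewrite /code /weight prefix_sum_total big1 // => x _; rewrite inE.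
      split.
        split=> //=.
        - by rewrite RI // mul1n.
        - by move=> Q; rewrite inE => /eqP->; apply: reachable0.
        - by move=> Q; rewrite inE => /eqP->; rewrite cards0.
        - move=> Q; rewrite -[(Posz (code Q) == _)]/(Posz (code Q) == Posz 0) eqz_nat.
          rewrite -[in code Q == _]c0 (inj_eq code_inj) inE [set0 == Q]eq_sym.
          by case: eqVneq => // _; rewrite (U2.2 aDict) // (U1.2 aDict).
      case=> // _; split=> [j|]; first by rewrite /= AI // inE.
      by split=> [j|j|j j'|a b _]; rewrite inE.
    * by left; rewrite /= RI.
    * by move=> C cC; right; exists 0; split.
  + by rewrite /=; lia.
- by rewrite /=; lia.
Qed.

End Search.

(** * From the finished search to an optimal schedule *)

Lemma makespan_finite (S : schedule I) : 0 < k -> k_schedule S ->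
  exists C, makespan S = (C%:E)%E.
Proof.
move=> k0 [_ leS]; have /card_gt0P[j jS] := leq_trans k0 leS.
have noty : makespan S <> (+oo)%E.
  rewrite /makespan; elim/big_ind: _ => // [x y hx hy|i _].
    by rewrite /Order.max; case: ifP.
  by rewrite /slot; case: (S i) => [[]|].
have : (slot S j <= makespan S)%O.
  exact: (@le_bigmax_cond _ _ _ _ _ (mem (selected S))).
move: jS; rewrite inE /slot; case: (S j) => [[p s]|] // _.
by case: (makespan S) noty => [C _ _||//] //; exists C.
Qed.

Lemma progress_set_round (goals : int -> Prop) a st v :
  progress goals a st -> progress goals a (set_reg st rRound v).
Proof.
have U := sem_unchanged st (isT : straight (rRound ::= EConst v)).
move=> [qs [e S out H]]; exists qs.
have [out' _] := output_unchanged U isT out.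
by split=> //; [apply: env_unchanged U isT e | apply: store_unchanged U isT S].
Qed.

Lemma progress_solves t st : 0 < k -> (forall j, (t < r j)%R) ->
  progress (completable (@set0 V) t) k st -> solves I st.
Proof.
move=> k0 tr [qs [e S out H]].
(* After [k] passes a hopeful record would have at least [k] jobs, contradicting [table_lt]; so
   every attainable deadline has been met. *)
have fnd C : completable (@set0 V) t C -> found_by C st.
  move/H=> [//|[d [/andP[_ ltd] kd _]]].
  by have := table_lt S.1 (mem_nth set0 ltd); rewrite ltnNge kd.
have best (S' : schedule I) : k_schedule S' -> exists2 C, makespan S' = (C%:E)%E & found_by C st.
  move=> kS'; have [C EC] := makespan_finite k0 kS'; exists C => //.
  by apply: fnd; apply: (completable_of_schedule kS' _ tr); rewrite EC.
case: out => [nf|[f1 [Q [leQ sel PS]]]]; [right | left]; split=> //.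
  by move=> S' /best[C _ [f1 _]]; rewrite f1 in nf.
have [S' [feas selS mkS repS]] := schedule_of_partial PS.
exists S'; split.
  move=> j; have := repS j; case: (S' j) => [[p s] [jQ Ep Es]|jQ].
    by rewrite sel jQ Ep Es.
  by rewrite sel (negPf jQ).
split; first by split; rewrite // selS.
move=> S2 /best[C -> [_ leC]]; apply: le_trans mkS _.
by rewrite lee_fin.
Qed.

(** The degenerate inputs take constant time, and the summand 1 covers those for which the product
    vanishes. Otherwise [0 < k <= n], which lets the product absorb the initialisation and the
    overhead of the [k] rounds. *)
Lemma main_spec : runs main (input_state I) (5000 * (8 ^ k * k * (n + E) + 1)) (solves I).
Proof.
have [k0|k0] := posnP k.
  apply: runs_weak (runs_if (n := 2) _) _ (fun st H => H); last by rewrite /=; lia.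
  rewrite [holds _ _]/= k0.
  apply: runs_weak (runs_straight _ _) _ (fun st H => H) => //.
  (* The output arrays are initially 0, so they already represent the empty schedule, whose makespan
     [-oo] is least. *)
  left; split=> //; exists [ffun=> None]; split=> [j|]; first by rewrite ffunE.
  have sel0 : selected ([ffun=> None] : schedule I) = set0.
    by apply/setP=> j; rewrite !inE ffunE.
  split; last by move=> S' _; rewrite /makespan sel0 big_set0 leNye.
  split; last by rewrite k0.
  by split=> [i j p s|j p s|a b q t _]; rewrite ffunE.
apply: runs_weak (runs_if (n := 3000 * (8 ^ k * k * (n + E) + 1)) _) _ (fun st H => H);
  last by rewrite /=; lia.
rewrite [holds _ _]/= lez_nat leqNgt k0.
apply: runs_weak (runs_if (n := 2500 * (8 ^ k * k * (n + E) + 1)) _) _ (fun st H => H);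
  last by rewrite /=; lia.
rewrite [holds _ _]/= !lez_nat; case: ifPn => [/andP[lekn m0]|no]; last first.
  apply: runs_weak (runs_straight _ _) _ (fun st H => H); [by [] | | by rewrite /=; lia].
  right; split=> // S' [_ leS].
  have le1 : #|selected S'| <= n by rewrite -[X in _ <= X]card_ord max_card.
  have /card_gt0P[j] := leq_trans k0 leS; rewrite inE.
  case: (S' j) => [[p s]|] // _; have := ltn_ord p; move: no.
  by rewrite (leq_trans leS le1) /= => /negP no lt; apply: no; apply: leq_ltn_trans lt.
apply: runs_weak (runs_seq (n2 := k * (2100 * (n + E) * 8 ^ k + 10) + 8)
  (init_spec k0 lekn m0) _) _ (fun st H => H).
  move=> st [t tr P0].
  apply: runs_weak (runs_for (n := k) (kb := 2100 * (n + E) * 8 ^ k)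
    (Inv := progress (completable (@set0 V) t)) _ _ _ _) _ _.
  - by [].
  - by case: P0 => qs [e _ _ _]; apply: env_target e.
  - exact: progress_set_round.
  - move=> x st' _ _ P'; apply: runs_weak (pass_spec k0 lekn m0 P') _ _ => // st2.
    exact: progress_set_round.
  - by lia.
  by move=> st' [P' _]; apply: progress_solves tr P'.
have := expn_gt0 8 k; move: (8 ^ k) => b /= b0.
have h1 : n <= b * k * (n + E).
  by apply: leq_trans (leq_addr E n) _; rewrite leq_pmull // muln_gt0 b0.
have h2 : k <= b * k * (n + E) by apply: leq_trans lekn h1.
have -> : k * (2100 * (n + E) * b + 10) = 2100 * (b * k * (n + E)) + 10 * k by lia.
by move: (b * k * (n + E)) h1 h2 => x; lia.
Qed.

End Correctness.

Theorem theorem2 :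
  exists (P : cmd) (c : nat), forall I : instance,
    exists (t : nat) (st : state),
      [/\ exec P (input_state I) t st,
          solves I st
        & t <= c * (8 ^ target I * target I * (jobs I + size (arcs I)) + 1)].
Proof.
exists main, 5000 => I; have [t [st [ex le sol]]] := main_spec I.
by exists t, st.
Qed.
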